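(* The (global) query stability problem for monotonic data-aware business processes (MDABPs) is undecidable in data complexity, in process complexity and in query complexity. It is also undecidable in instance complexity, except for fresh MDABPs, for which instance complexity is constant. Undecidability already holds when the MDABPs are restricted to be acyclic.
   Context: Fix an infinite set $\mathit{dom}$ of constants and use the positive rationals $\mathbb{Q}^+$ as timestamps; let $\mathit{dom}_{\mathbb{Q}^+}=\mathit{dom}\cup\mathbb{Q}^+$. A database instance is a finite set of ground facts over a schema with values in $\mathit{dom}_{\mathbb{Q}^+}$. An MDABP is a pair $\mathcal{B}=\langle\mathcal{P},\mathcal{C}\rangle$. The process model $\mathcal{P}=\langle N,L\rangle$ consists of a finite directed multigraph $N=\langle P,T\rangle$ (vertices $P$ are places, among them a distinguished place $\mathit{start}$; edges $T$ are transitions) and a labeling $L$ assigning to each transition $t$ a pair $(E_t,W_t)$. $\mathit{In}$ is a distinguished relation symbol; $\Sigma_{\mathcal B}$ denotes the schema of $\mathcal B$ without $\mathit{In}$ and $\Sigma_{\mathcal B,\mathit{In}}=\Sigma_{\mathcal B}\cup\{\mathit{In}\}$. The execution condition $E_t$ is a Boolean conjunctive query over $\Sigma_{\mathcal B,\mathit{In}}$; the writing rule $W_t$ is a rule $R(\bar u)\leftarrow B_t(\bar u)$ with $R\in\Sigma_{\mathcal B}$ and $B_t$ a conjunctive query over $\Sigma_{\mathcal B,\mathit{In}}$ of the arity of $R$; $E_t$ and $B_t$ may contain negated atoms and comparisons ($<,\le$) between a variable and a timestamp constant. For an instance $\mathcal D$, $W_t(\mathcal D)=\{R(\bar c)\mid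 \bar c\in B_t(\mathcal D)\}$. A configuration is $\mathcal C=\langle\mathcal I,\mathcal D,\tau\rangle$ where $\mathcal D$ is a database over $\Sigma_{\mathcal B}$, $\tau\in\mathbb{Q}^+$ is the current time, and $\mathcal I=\langle O,M_{\mathit{In}},M_P\rangle$ with $O$ a finite set of process instances, $M_{\mathit{In}}(o)=\mathit{In}(\bar c,\tau_o)$ the input record of $o$ ($\tau_o$ its start timestamp) and $M_P(o)\in P$ its current place. One writes $\mathcal B=\langle\mathcal P,\mathcal I,\mathcal D,\tau\rangle$ or $\langle\mathcal P,\mathcal I,\mathcal D\rangle$. Atomic steps: (i) traversal: an instance $o$ at place $q$ with record $\mathit{In}(\bar c,\tau')$ may traverse a transition $t$ from $q$ to $p$ if $E_t$ is true in $\mathcal D\cup\{\mathit{In}(\bar c,\tau')\}$; the new configuration has database $\mathcal D\cup W_t(\mathcal D\cup\{\mathit{In}(\bar c,\tau')\})$, $o$ at $p$, everything else unchanged; (ii) start: a fresh instance with record $\mathit{In}(\bar c',\tau')$, $\tau'\ge\tau$, is added at place $\mathit{start}$, the current time becomes $\tau'$, the database is unchanged. An execution is a finite sequence of configurations beginning with $\mathcal C$, each obtained from its predecessor by an atomic step. A conjunctive query $Q$ is stable in $\mathcal B$ until $\tau$ if for every execution from $\mathcal C$ (database $\mathcal D$) to a configuration with database $\mathcal D'$ and timestamp $\tau'<\tau$ we have $Q(\mathcal D)=Q(\mathcal D')$; globally stable means stable until $\infty$. The stability problem: given $\mathcal P$, $\mathcal I$, $\mathcal D$, $\tau$ and a conjunctive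 query $Q$, decide whether $Q$ is globally stable in $\langle\mathcal P,\mathcal I,\mathcal D,\tau\rangle$. Data/process/instance/query complexity means that all parameters are fixed except the database / the process model / the instance part / the query, respectively. An MDABP is fresh if its configuration contains no running instances, and acyclic if its process net is cycle-free. *)

(* Defs.v *)
From HB Require Import structures.
From mathcomp Require Import all_boot all_order all_algebra.
From Stdlib Require Import Relations.

Set Implicit Arguments.
Unset Strict Implicit.
Unset Printing Implicit Defensive.

Inductive prog : Type :=
| PZero
| PSucc
| PProj (i : nat)
| PComp (f : prog) (gs : seq prog)
| PRec (f g : prog)
| PMu (f : prog).

Inductive peval : prog -> seq nat -> nat -> Prop :=
| ev_zero v : peval PZero v 0
| ev_succ v : peval PSucc v (nth 0 v 0).+1
| ev_proj i v : peval (PProj i) v (nth 0 v i)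
| ev_comp f gs v ws y :
    pevals gs v ws -> peval f ws y -> peval (PComp f gs) v y
| ev_rec0 f g v y : peval f v y -> peval (PRec f g) (0 :: v) y
| ev_recS f g n v z y :
    peval (PRec f g) (n :: v) z -> peval g (n :: z :: v) y ->
    peval (PRec f g) (n.+1 :: v) y
| ev_mu f v n :
    peval f (n :: v) 0 ->
    (forall m, m < n -> exists k, peval f (m :: v) k.+1) ->
    peval (PMu f) v n
with pevals : seq prog -> seq nat -> seq nat -> Prop :=
| evs_nil v : pevals [::] v [::]
| evs_cons g gs v w ws :
    peval g v w -> pevals gs v ws -> pevals (g :: gs) v (w :: ws).

Definition decidable_on (X : countType) (A S : X -> Prop) : Prop :=
  exists c : prog, forall x, A x ->
    (S x -> peval c [:: pickle x] 1) /\ (~ S x -> peval c [:: pickle x] 0).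

Definition posrat := {q : rat | (0 < q)%R}.

(* dom is modelled by nat; values of dom_Q+ = dom + Q+ *)
Definition value := (nat + posrat)%type.
(* terms: variables (inl) or constants (inr) *)
Definition term := (nat + value)%type.
(* relation symbols are naturals; the symbol 0 is the distinguished In *)
Definition In_sym : nat := 0.
Definition atom := (nat * seq term)%type.
(* comparison (x, c, (strict, varleft)):
   varleft = true  : x < c  (strict) or x <= c
   varleft = false : c < x  (strict) or c <= x *)
Definition cmp := (nat * posrat * (bool * bool))%type.
(* conjunctive body: positive atoms, negated atoms, comparisons *)
Definition body := (seq atom * seq atom * seq cmp)%type.
(* writing rule R(u) <- B(u) : (R, u, B) *)
Definition rule := (nat * seq nat * body)%type.
(* transition: (source place, target place, E_t, W_t) *)
Definition transition := (nat * nat * body * rule)%type.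
(* schema Sigma_B : list of (relation symbol, arity) *)
Definition schema := seq (nat * nat)%type.
(* process model: (schema, arity of the data part of In, places, start,
   transitions (a list, so a multigraph)) *)
Definition process := (schema * nat * seq nat * nat * seq transition)%type.

Definition p_schema (P : process) : schema := P.1.1.1.1.
Definition p_inar (P : process) : nat := P.1.1.1.2.
Definition p_places (P : process) : seq nat := P.1.1.2.
Definition p_start (P : process) : nat := P.1.2.
Definition p_trans (P : process) : seq transition := P.2.

Definition t_src (t : transition) : nat := t.1.1.1.
Definition t_tgt (t : transition) : nat := t.1.1.2.
Definition t_E (t : transition) : body := t.1.2.
Definition t_W (t : transition) : rule := t.2.

Definition fact := (nat * seq value)%type.
Definition database := seq fact.
(* input record In(c, tau_o) *)
Definition record := (seq value * posrat)%type.
(* instance part: finite list of process instances, each with its current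
   place M_P(o) and input record M_In(o) *)
Definition instpart := seq (nat * record)%type.
(* (plain) conjunctive query: head variables and body atoms *)
Definition query := (seq nat * seq atom)%type.

Definition In_fact (r : record) : fact := (In_sym, r.1 ++ [:: inr r.2]).

Definition valuation := nat -> value.
Definition dbset := fact -> Prop.

Definition eval_term (nu : valuation) (t : term) : value :=
  match t with inl x => nu x | inr c => c end.

Definition holds_atom (D : dbset) (nu : valuation) (a : atom) : Prop :=
  D (a.1, map (eval_term nu) a.2).

Definition holds_cmp (nu : valuation) (c : cmp) : Prop :=
  match nu c.1.1 with
  | inr q =>
      let x := sval q in let k := sval c.1.2 in
      match c.2 with
      | (true, true) => (x < k)%R
      | (false, true) => (x <= k)%R
      | (true, false) => (k < x)%R
      | (false, false) => (k <= x)%R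
      end
  | inl _ => False
  end.

Definition holds_body (D : dbset) (nu : valuation) (b : body) : Prop :=
  (forall a, a \in b.1.1 -> holds_atom D nu a) /\
  (forall a, a \in b.1.2 -> ~ holds_atom D nu a) /\
  (forall c, c \in b.2 -> holds_cmp nu c).

Definition sat_bool (D : dbset) (b : body) : Prop :=
  exists nu, holds_body D nu b.

Definition rule_out (D : dbset) (w : rule) : dbset :=
  fun f => f.1 = w.1.1 /\ exists nu, holds_body D nu w.2 /\ f.2 = map nu w.1.2.

Definition db_of (D : database) : dbset := fun f => f \in D.

Record config := Cfg { c_inst : instpart; c_db : dbset; c_time : posrat }.

Inductive step (P : process) : config -> config -> Prop :=
| step_traverse s1 s2 q r t D tau :
    t \in p_trans P -> t_src t = q ->
    let D1 := fun f => D f \/ f = In_fact r in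
    sat_bool D1 (t_E t) ->
    step P (Cfg (s1 ++ (q, r) :: s2) D tau)
           (Cfg (s1 ++ (t_tgt t, r) :: s2)
                (fun f => D f \/ rule_out D1 (t_W t) f) tau)
| step_start I D tau cs tau' :
    size cs = p_inar P -> (sval tau <= sval tau')%R ->
    step P (Cfg I D tau) (Cfg (I ++ [:: (p_start P, (cs, tau'))]) D tau').

Definition reaches (P : process) : config -> config -> Prop :=
  clos_refl_trans config (step P).

Definition q_ans (D : dbset) (Q : query) (tup : seq value) : Prop :=
  exists nu, (forall a, a \in Q.2 -> holds_atom D nu a) /\ tup = map nu Q.1.

Definition globally_stable (P : process) (I : instpart) (D : database)
    (tau : posrat) (Q : query) : Prop :=
  forall C', reaches P (Cfg I (db_of D) tau) C' ->
    forall tup, q_ans (db_of D) Q tup <-> q_ans (c_db C') Q tup.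

Definition term_vars (ts : seq term) : seq nat :=
  pmap (fun t : term => if t is inl x then Some x else None) ts.

Definition wf_atom (sch : schema) (inar : nat) (allowIn : bool) (a : atom) :=
  if a.1 == In_sym then allowIn && (size a.2 == inar.+1)
  else (a.1, size a.2) \in sch.

Definition wf_body (sch : schema) (inar : nat) (b : body) : Prop :=
  (forall a, a \in b.1.1 ++ b.1.2 -> wf_atom sch inar true a).

Definition pos_vars (b : body) : seq nat := flatten [seq term_vars a.2 | a <- b.1.1].

Definition wf_rule (sch : schema) (inar : nat) (w : rule) : Prop :=
  w.1.1 != In_sym /\ (w.1.1, size w.1.2) \in sch /\ wf_body sch inar w.2 /\
  (* safety, so that W_t(D) is finite *)
  (forall x, x \in w.1.2 -> x \in pos_vars w.2) /\
  (forall a, a \in w.2.1.2 -> forall x, x \in term_vars a.2 -> x \in pos_vars w.2) /\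
  (forall c, c \in w.2.2 -> c.1.1 \in pos_vars w.2).

Definition wf_process (P : process) : Prop :=
  uniq (map fst (p_schema P)) /\
  (forall p, p \in p_schema P -> p.1 != In_sym) /\
  p_start P \in p_places P /\
  (forall t, t \in p_trans P ->
     [/\ t_src t \in p_places P, t_tgt t \in p_places P,
         wf_body (p_schema P) (p_inar P) (t_E t) &
         wf_rule (p_schema P) (p_inar P) (t_W t)]).

Definition wf_fact (sch : schema) (f : fact) : Prop :=
  f.1 != In_sym /\ (f.1, size f.2) \in sch.

Definition wf_input (P : process) (I : instpart) (D : database) (Q : query) : Prop :=
  wf_process P /\
  (forall o, o \in I -> o.1 \in p_places P /\ size o.2.1 = p_inar P) /\
  (forall f, f \in D -> wf_fact (p_schema P) f) /\
  (forall a, a \in Q.2 -> wf_atom (p_schema P) (p_inar P) false a) /\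
  (forall x, x \in Q.1 -> x \in flatten [seq term_vars a.2 | a <- Q.2]).

Definition edge (P : process) (p q : nat) : Prop :=
  exists2 t, t \in p_trans P & t_src t = p /\ t_tgt t = q.

Definition acyclic (P : process) : Prop :=
  forall p, ~ clos_trans nat (edge P) p p.

Definition fresh (I : instpart) : Prop := I = [::].

(* Main.v *)
Require Import Defs.
From Stdlib Require Import Relations Classical.
From mathcomp Require Import all_boot all_order all_algebra.
From mathcomp Require Import zify.
Import Order.TTheory GRing.Theory Num.Theory.

Set Implicit Arguments.
Unset Strict Implicit.
Unset Printing Implicit Defensive.

(** A single acyclic process interprets all partial recursive programs.
    Programs, lists and numbers are stored as constructor cells
    Cell(x, tag, a, b), and the inductive clauses of [peval], being Horn clauses
    once the bounded quantifier of minimization is unfolded into an auxiliary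
    relation, are the writing rules.  Fresh instances supply new cell names;
    negation is used only to claim a name once, so that a cell is never
    redefined and every derived evaluation fact is true.  A program together
    with its input can be placed in the database, in the records of running
    instances, in the transitions, or in the query (as a conjunction of cell
    atoms that the process may build by itself).  A decider of stability would
    then decide whether a program returns 1 on the code of its own encoding. *)

(** The obstacle is that executions are adversarial: an instance may start at any moment with any
    record, so meaningless cells cannot be kept out of the database. Truth is therefore partial
    correctness relative to a store of cells: a fact about the names of a program and a list claims
    something only when those names denote a program and a list. The one property of the store that
    this needs is that a name has at most one cell, and this is what claiming protects. Claimed
    names are timestamps because comparisons fail on constants, so a rule can tell them apart from
    the constants that name a given program, and no execution can tamper with the latter. Distinct
    names may denote the same number or list, so existing cells never have to be searched for.
    Claiming and writing are separate transitions because a transition fills only one relation; the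
    record waits at an intermediate place in between. *)

(* The generated schemes have no induction hypothesis under the existential
   of [ev_mu]. *)
Section PevalInd.
Variables (P : prog -> seq nat -> nat -> Prop).
Variables (Ps : seq prog -> seq nat -> seq nat -> Prop).
Hypothesis Pzero : forall v, P PZero v 0.
Hypothesis Psucc : forall v, P PSucc v (nth 0 v 0).+1.
Hypothesis Pproj : forall i v, P (PProj i) v (nth 0 v i).
Hypothesis Pcomp : forall f gs v ws y,
  Ps gs v ws -> P f ws y -> P (PComp f gs) v y.
Hypothesis Prec0 : forall f g v y, P f v y -> P (PRec f g) (0 :: v) y.
Hypothesis PrecS : forall f g n v z y,
  P (PRec f g) (n :: v) z -> P g (n :: z :: v) y -> P (PRec f g) (n.+1 :: v) y.
Hypothesis Pmu : forall f v n, P f (n :: v) 0 ->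
  (forall m, m < n -> exists k, P f (m :: v) k.+1) -> P (PMu f) v n.
Hypothesis Psnil : forall v, Ps [::] v [::].
Hypothesis Pscons : forall g gs v w ws,
  P g v w -> Ps gs v ws -> Ps (g :: gs) v (w :: ws).

Fixpoint peval_nested_ind p v y (H : peval p v y) {struct H} : P p v y :=
  match H with
  | ev_zero v => Pzero v
  | ev_succ v => Psucc v
  | ev_proj i v => Pproj i v
  | ev_comp _ _ _ _ _ Hg Hf =>
      Pcomp (pevals_nested_ind Hg) (peval_nested_ind Hf)
  | ev_rec0 _ g _ _ Hf => Prec0 g (peval_nested_ind Hf)
  | ev_recS _ _ _ _ _ _ Hz Hy =>
      PrecS (peval_nested_ind Hz) (peval_nested_ind Hy)
  | ev_mu _ _ _ H0 HS =>
      Pmu (peval_nested_ind H0)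
        (fun m mn => let: ex_intro k Hk := HS m mn in
                     ex_intro _ k (peval_nested_ind Hk))
  end
with pevals_nested_ind ps v ys (H : pevals ps v ys) {struct H} : Ps ps v ys :=
  match H with
  | evs_nil v => Psnil v
  | evs_cons _ _ _ _ _ Hg Hgs =>
      Pscons (peval_nested_ind Hg) (pevals_nested_ind Hgs)
  end.

End PevalInd.

Lemma peval_det p v y z : peval p v y -> peval p v z -> y = z.
Proof.
move=> H; move: z.
apply: (@peval_nested_ind (fun p v y => forall z, peval p v z -> y = z)
  (fun ps v ys => forall zs, pevals ps v zs -> ys = zs) _ _ _ _ _ _ _ _ _ _ _ _ H)
  => {p v y H}.
- by move=> v z H; inversion H.
- by move=> v z H; inversion H.
- by move=> i v z H; inversion H.
- move=> f gs v ws y IHg IHf z H; inversion H as [| | |? ? ? ws' ? Hg Hf| | |]; subst.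
  by move: Hf; rewrite -(IHg _ Hg); apply: IHf.
- by move=> f g v y IH z H; inversion H; subst; apply: IH.
- move=> f g n v z y IHz IHy z' H; inversion H as [| | | | |? ? ? ? w ? Hw Hz|]; subst.
  by move: Hz; rewrite -(IHz _ Hw); apply: IHy.
- move=> f v n IH0 IHS m H; inversion H as [| | | | | |? ? ? Hm0 HmS]; subst.
  have [nm|mn|//] := ltngtP n m.
  + by have [k /IH0] := HmS _ nm.
  + by have [k /(_ _ Hm0)] := IHS _ mn.
- by move=> v zs H; inversion H.
- move=> g gs v w ws IHw IHws zs H; inversion H as [|? ? ? w' ws' Hw Hws]; subst.
  by rewrite (IHw _ Hw) (IHws _ Hws).
Qed.

(** * Computable functions and the codes of data *)

Definition computable (a : nat) (f : seq nat -> nat) : Prop :=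
  exists c, forall v, size v = a -> peval c v (f v).

Lemma computable_const a n : computable a (fun=> n).
Proof.
elim: n => [|n [c Hc]]; first by exists PZero => v _; constructor.
exists (PComp PSucc [:: c]) => v Hv.
apply: (ev_comp (ws := [:: n])); last exact: (ev_succ [:: n]).
by do 2?constructor; apply: Hc.
Qed.

Lemma computable_nth a i : computable a (fun v => nth 0 v i).
Proof. by exists (PProj i) => v _; constructor. Qed.

Lemma computable_succ a f : computable a f -> computable a (fun v => (f v).+1).
Proof.
case=> c Hc; exists (PComp PSucc [:: c]) => v Hv.
apply: (ev_comp (ws := [:: f v])); last exact: (ev_succ [:: f v]).
by do 2?constructor; apply: Hc.
Qed.

Lemma computable_comp1 a (h f : _ -> nat) :
  computable 1 (fun v => h (nth 0 v 0)) -> computable a f ->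
  computable a (fun v => h (f v)).
Proof.
case=> d Hd [c Hc]; exists (PComp d [:: c]) => v Hv.
apply: (ev_comp (ws := [:: f v])); last exact: (Hd [:: f v]).
by do 2?constructor; apply: Hc.
Qed.

Lemma pevals_projections v : pevals (mkseq PProj (size v)) v v.
Proof.
have H k j : j + k = size v -> pevals (map PProj (iota j k)) v (drop j v).
  elim: k j => [|k IH] j Ej; first by rewrite drop_oversize; [constructor | lia].
  rewrite (drop_nth 0); last lia.
  by constructor; [constructor | apply: IH; lia].
by have := H (size v) 0 (add0n _); rewrite drop0.
Qed.

(** [PRec] recurses on the first argument and passes the others on as parameters, so the argument
    list has to be rebuilt by projections. This is why [computable] fixes its length. *)
Lemma computable_rec a n f g :
  computable a n -> computable a f -> computable a.+2 g ->
  computable a (fun v => nat_rect _ (f v) (fun i z => g [:: i, z & v]) (n v)).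
Proof.
case=> cn Hn [cf Hf] [cg Hg]; exists (PComp (PRec cf cg) (cn :: mkseq PProj a)).
move=> v Hv; apply: (ev_comp (ws := n v :: v)).
  by constructor; [apply: Hn | rewrite -Hv; apply: pevals_projections].
elim: (n v) => [|m IH] /=; first by constructor; apply: Hf.
by apply: ev_recS; [exact: IH | apply: Hg => /=; rewrite Hv].
Qed.

Lemma computable_ext a f g :
  (forall v, f v = g v) -> computable a f -> computable a g.
Proof. by move=> E [c Hc]; exists c => v Hv; rewrite -E; apply: Hc. Qed.

Lemma computable_double a f : computable a f -> computable a (fun v => (f v).*2).
Proof.
move=> Hf; pose g (v : seq nat) := (nth 0 v 1).+2.
have Hg : computable a.+2 g by do 2!apply: computable_succ; apply: computable_nth.
apply: computable_ext (computable_rec Hf (computable_const a 0) Hg) => v.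
by elim: (f v) => //= n ->; rewrite doubleS.
Qed.

(** [2 ^ x * y.*2.+1] is the code of a list with head [x] and tail coded by [y]. All of [pickle]
    reduces to it: a pair is coded as a list of length two, an option as a list of length at most
    one, a sum as a pair of options. *)
Lemma computable_code_cons a f g : computable a f -> computable a g ->
  computable a (fun v => 2 ^ f v * (g v).*2.+1).
Proof.
move=> Hf Hg.
have Hd : computable a.+2 (fun v => (nth 0 v 1).*2).
  exact/computable_double/computable_nth.
have Hb := computable_succ (computable_double Hg).
apply: computable_ext (computable_rec Hf Hb Hd) => v /=.
by elim: (f v) => [|n IH] /=; rewrite ?mul1n // IH expnS; lia.
Qed.

Section Pickle.
Variables (a : nat) (S T : countType).
Implicit Types (f : seq nat -> S) (g : seq nat -> T).

Lemma computable_pickle_pair f g :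
  computable a (fun v => pickle (f v)) -> computable a (fun v => pickle (g v)) ->
  computable a (fun v => pickle (f v, g v)).
Proof.
move=> Hf Hg; apply: computable_code_cons Hf _.
exact: computable_code_cons Hg (computable_const a 0).
Qed.

Lemma computable_pickle_cons f (s : seq nat -> seq S) :
  computable a (fun v => pickle (f v)) -> computable a (fun v => pickle (s v)) ->
  computable a (fun v => pickle (f v :: s v)).
Proof. exact: computable_code_cons. Qed.

Lemma computable_pickle_inl f :
  computable a (fun v => pickle (f v)) -> computable a (fun v => pickle (inl (f v) : S + T)).
Proof.
move=> Hf; apply: computable_code_cons (computable_const _ _).
exact: computable_code_cons Hf (computable_const a 0).
Qed.

Lemma computable_pickle_inr g :
  computable a (fun v => pickle (g v)) -> computable a (fun v => pickle (inr (g v) : S + T)).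
Proof.
move=> Hg; apply: computable_code_cons (computable_const _ _) _.
apply: computable_code_cons _ (computable_const a 0).
exact: computable_code_cons Hg (computable_const a 0).
Qed.

End Pickle.

(** * Programs and inputs as cells *)

Notation tZero := 0 (only parsing).
Notation tSucc := 1 (only parsing).
Notation tNil := 2 (only parsing).
Notation tCons := 3 (only parsing).
Notation tPZero := 4 (only parsing).
Notation tPSucc := 5 (only parsing).
Notation tPHead := 6 (only parsing).
Notation tPTail := 7 (only parsing).
Notation tPComp := 8 (only parsing).
Notation tPRec := 9 (only parsing).
Notation tPMu := 10 (only parsing).

(* (x, t, a, b): the cell named x carries the constructor t with arguments the
   cells a and b; a missing argument is 0. *)
Definition cell := (nat * nat * nat * nat)%type.
Definition cname (q : cell) : nat := q.1.1.1.

(* Even names are reserved for numerals, 1 for the input list, 3 for nil. *)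
Definition pname (k : nat) : nat := k.*2 + 5.

(** [PSucc] takes two cells: the second is a projection to the head, which lets the interpreter read
    the first argument, with its default 0 on the empty list, through the rules for projections. *)
Fixpoint psize (p : prog) : nat :=
  match p with
  | PZero => 1
  | PSucc => 2
  | PProj i => i.+1
  | PComp f gs => (psize f + sumn (map (fun g => (psize g).+1) gs)).+2
  | PRec f g => (psize f + psize g).+1
  | PMu f => (psize f).+1
  end.

Definition pssize (gs : seq prog) : nat :=
  (sumn (map (fun g => (psize g).+1) gs)).+1.

Fixpoint proj_cells (i k : nat) : seq cell :=
  if i is j.+1 then (pname k, tPTail, pname k.+1, 0) :: proj_cells j k.+1
  else [:: (pname k, tPHead, 0, 0)].

(* The cells of p are named pname k, ..., pname (k + psize p - 1), root first. *)
Fixpoint prog_cells (p : prog) (k : nat) : seq cell :=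
  match p with
  | PZero => [:: (pname k, tPZero, 0, 0)]
  | PSucc => (pname k, tPSucc, pname k.+1, 0) :: proj_cells 0 k.+1
  | PProj i => proj_cells i k
  | PComp f gs =>
      let fix progs_cells (gs : seq prog) (k : nat) : seq cell :=
        if gs is g :: gs' then
          (pname k, tCons, pname k.+1, pname (k.+1 + psize g))
            :: prog_cells g k.+1 ++ progs_cells gs' (k.+1 + psize g)
        else [:: (pname k, tNil, 0, 0)] in
      (pname k, tPComp, pname k.+1, pname (k.+1 + psize f))
        :: prog_cells f k.+1 ++ progs_cells gs (k.+1 + psize f)
  | PRec f g =>
      (pname k, tPRec, pname k.+1, pname (k.+1 + psize f))
        :: prog_cells f k.+1 ++ prog_cells g (k.+1 + psize f)
  | PMu f => (pname k, tPMu, pname k.+1, 0) :: prog_cells f k.+1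
  end.

(** A convertible copy of the local fixpoint that the nested recursion forces inside
    [prog_cells]. *)
Fixpoint progs_cells (gs : seq prog) (k : nat) : seq cell :=
  if gs is g :: gs' then
    (pname k, tCons, pname k.+1, pname (k.+1 + psize g))
      :: prog_cells g k.+1 ++ progs_cells gs' (k.+1 + psize g)
  else [:: (pname k, tNil, 0, 0)].

Lemma prog_cells_comp f gs k :
  prog_cells (PComp f gs) k =
  (pname k, tPComp, pname k.+1, pname (k.+1 + psize f))
    :: prog_cells f k.+1 ++ progs_cells gs (k.+1 + psize f).
Proof. by []. Qed.

Section ProgInd.
Variable P : prog -> Prop.
Hypothesis Pzero : P PZero.
Hypothesis Psucc : P PSucc.
Hypothesis Pproj : forall i, P (PProj i).
Hypothesis Pcomp : forall f gs, P f -> foldr (fun g => and (P g)) True gs ->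
  P (PComp f gs).
Hypothesis Prec : forall f g, P f -> P g -> P (PRec f g).
Hypothesis Pmu : forall f, P f -> P (PMu f).

Fixpoint prog_nested_ind (p : prog) : P p :=
  match p with
  | PZero => Pzero
  | PSucc => Psucc
  | PProj i => Pproj i
  | PComp f gs =>
      Pcomp (prog_nested_ind f)
        ((fix all_ind gs : foldr (fun g => and (P g)) True gs :=
            if gs is g :: gs' then conj (prog_nested_ind g) (all_ind gs') else I)
           gs)
  | PRec f g => Prec (prog_nested_ind f) (prog_nested_ind g)
  | PMu f => Pmu (prog_nested_ind f)
  end.

End ProgInd.

Fixpoint chain_cells (n : nat) : seq cell :=
  if n is m.+1 then (m.*2.+2, tSucc, m.*2, 0) :: chain_cells m else [::].

(** These cells depend on the program alone; their code can therefore serve as the number on which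
    the program is run. *)
Definition base_cells (p : prog) : seq cell :=
  (0, tZero, 0, 0) :: (3, tNil, 0, 0) :: prog_cells p 0.

Definition run_cells (p : prog) (n : nat) : seq cell :=
  (1, tCons, n.*2, 3) :: chain_cells n ++ base_cells p.

Lemma proj_cells_names i k :
  map cname (proj_cells i k) = map pname (iota k i.+1).
Proof. by elim: i k => //= i IH k; rewrite IH. Qed.

Lemma prog_cells_names p k :
  map cname (prog_cells p k) = map pname (iota k (psize p)).
Proof.
elim/prog_nested_ind: p k => [||i|f gs IHf IHgs|f g IHf IHg|f IHf] k //.
- exact: proj_cells_names.
- rewrite prog_cells_comp.
  have IHs j : map cname (progs_cells gs j) = map pname (iota j (pssize gs)).
    elim: gs IHgs j => [//|g gs IH] [IHg IHgs] j.
    rewrite [LHS]/= map_cat IHg (IH IHgs) -map_cat -iotaD.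
    by rewrite /pssize /= addnS.
  rewrite [LHS]/= map_cat IHf IHs -map_cat -iotaD.
  by rewrite [psize _]/= /pssize addnS.
- by rewrite [LHS]/= map_cat IHf IHg -map_cat -iotaD.
- by rewrite [LHS]/= IHf.
Qed.

(** Parity separates the chain from the rest. Distinct names make the given cells a functional
    store, and they allow all of them to be claimed when the process builds them under
    timestamps. *)
Lemma run_cells_uniq p n : uniq (map cname (run_cells p n)).
Proof.
have chain_bound m q : q \in chain_cells m -> exists2 i, i < m & cname q = i.*2.+2.
  elim: m => //= m IH; rewrite inE => /orP[/eqP->|/IH [i im ->]]; first by exists m.
  by exists i => //; lia.
have Hbase : uniq (map cname (base_cells p)).
  rewrite /= prog_cells_names map_inj_uniq ?iota_uniq ?andbT; last first.
    by move=> i j; rewrite /pname; lia.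
  rewrite !inE /= /cname /=; apply/andP; split.
    by apply/mapP => -[i _]; rewrite /pname; lia.
  by apply/mapP => -[i _]; rewrite /pname; lia.
have base_odd x : x \in map cname (base_cells p) -> odd x || (x == 0).
  rewrite /= prog_cells_names !inE => /or3P[/eqP->|/eqP->|/mapP[i _ ->]] //.
  by rewrite /pname; lia.
have base_neq1 : 1 \notin map cname (base_cells p).
  rewrite /= prog_cells_names !inE /cname /=; apply/mapP => -[i _].
  by rewrite /pname; lia.
rewrite /run_cells map_cons cons_uniq map_cat mem_cat negb_or base_neq1 andbT.
rewrite cat_uniq Hbase andbT; apply/and3P; split.
- by apply/mapP => -[q /chain_bound[i _ ->]]; rewrite /cname /=; lia.
- elim: n => //= n ->; rewrite andbT.
  by apply/mapP => -[q /chain_bound[i Hi ->]]; rewrite /cname /=; lia.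
- apply/hasPn => x /base_odd Hx; apply/mapP => -[q /chain_bound[i Hi ->] Ex].
  by move: Hx; rewrite Ex; lia.
Qed.

(** * The diagonal argument *)

Section Diagonal.
Variables (X Y : countType) (enc : cell -> Y) (wrap : seq Y -> X) (rest : seq Y).
Variable (wrapn : nat -> nat).
Hypothesis computable_enc : forall a x t y z,
  computable a x -> computable a t -> computable a y -> computable a z ->
  computable a (fun v => pickle (enc (x v, t v, y v, z v))).
Hypothesis computable_wrapn : computable 1 (fun v => wrapn (nth 0 v 0)).
Hypothesis wrapnE : forall s, pickle (wrap s) = wrapn (pickle s).

(* The number fed to p is the code of the encoding of p itself, so that the
   self-applied instance is obtained from its own input by consing cells. *)
Lemma undecidable_of_run_cells (A S : X -> Prop) :
  (forall p n, A (wrap (map enc (run_cells p n) ++ rest))) ->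
  (forall p n, S (wrap (map enc (run_cells p n) ++ rest)) <-> ~ peval p [:: n] 1) ->
  ~ decidable_on A S.
Proof.
move=> HA HS [c Hc].
pose link i := pickle (enc (i.*2.+2, tSucc, i.*2, 0)).
pose chain m := nat_rect _ m (fun i z => 2 ^ link i * z.*2.+1).
(* If [n] codes the list of encoded cells still to come, [self n] is the code of the instance
   obtained by putting the numeral chain and the input list for [n] in front. *)
pose self n := wrapn (2 ^ pickle (enc (1, tCons, n.*2, 3)) * (chain n n).*2.+1).
have chainE s n : chain (pickle s) n = pickle (map enc (chain_cells n) ++ s).
  by elim: n => //= n ->.
have selfE s : self (pickle s) =
    pickle (wrap (enc (1, tCons, (pickle s).*2, 3)
                    :: map enc (chain_cells (pickle s)) ++ s)).
  by rewrite wrapnE /self chainE.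
have [d Hd] : computable 1 (fun v => self (nth 0 v 0)).
  have Hn a i : computable a (fun v => nth 0 v i) by apply: computable_nth.
  have Hk a k : computable a (fun=> k) by apply: computable_const.
  apply: (computable_comp1 (h := wrapn)) => //; apply: computable_code_cons.
    by apply: computable_enc => //; apply: computable_double.
  apply: (computable_rec (g := fun v => 2 ^ link (nth 0 v 0) * (nth 0 v 1).*2.+1)) => //.
  apply: computable_code_cons => //; apply: computable_enc => //.
    by do 2!apply: computable_succ; apply: computable_double.
  exact: computable_double.
(* [e] runs the assumed decider [c] on [self n], which for the following [n] is the instance asking
   about [e] on [n]. *)
pose e := PComp c [:: d].
pose n := pickle (map enc (base_cells e) ++ rest).
have He y : peval c [:: self n] y -> peval e [:: n] y.
  move=> H; apply: ev_comp H; constructor; last by constructor.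
  exact: (Hd [:: n]).
have En : self n = pickle (wrap (map enc (run_cells e n) ++ rest)).
  by rewrite selfE catA -map_cat.
have := Hc _ (HA e n); rewrite -En => -[H1 H0].
(* Stability would make the decider answer 1, so [e] would return 1 on [n], which means
   instability. *)
have nS : ~ S (wrap (map enc (run_cells e n) ++ rest)).
  by move=> HSx; move/HS: (HSx); apply; apply/He/H1.
(* Hence the answer is 0, and determinism keeps [e] from returning 1, which means stability. *)
by apply: (nS); apply/HS => E1; have := peval_det (He _ (H0 nS)) E1.
Qed.

End Diagonal.

Lemma forall_in_foldr (T : eqType) (Q : T -> Prop) (s : seq T) :
  (forall x, x \in s -> Q x) <-> foldr (fun x => and (Q x)) True s.
Proof.
elim: s => [|x s IH] //=; split=> [H|[Hx /IH Hs] y].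
  by split; [apply: H; rewrite mem_head | apply/IH => y Hy; apply: H; rewrite inE Hy orbT].
by rewrite inE => /orP[/eqP->|/Hs].
Qed.

(** * The objects denoted by names in a store of cells *)

Section Denotation.
Variable N : seq value -> Prop.

(** Being inductive, denotation ignores ill-formed and cyclic cells. A name may denote nothing, and
    an object may have many names. *)
Inductive dnat : value -> nat -> Prop :=
| dnat_zero x a b : N [:: x; inl tZero; a; b] -> dnat x 0
| dnat_succ x y b n : N [:: x; inl tSucc; y; b] -> dnat y n -> dnat x n.+1.

Inductive dlist : value -> seq nat -> Prop :=
| dlist_nil x a b : N [:: x; inl tNil; a; b] -> dlist x [::]
| dlist_cons x h t n v :
    N [:: x; inl tCons; h; t] -> dnat h n -> dlist t v -> dlist x (n :: v).

Inductive dprog : value -> prog -> Prop :=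
| dprog_zero x a b : N [:: x; inl tPZero; a; b] -> dprog x PZero
| dprog_succ x q b : N [:: x; inl tPSucc; q; b] -> dprog q (PProj 0) -> dprog x PSucc
| dprog_head x a b : N [:: x; inl tPHead; a; b] -> dprog x (PProj 0)
| dprog_tail x q b i :
    N [:: x; inl tPTail; q; b] -> dprog q (PProj i) -> dprog x (PProj i.+1)
| dprog_comp x y z f gs :
    N [:: x; inl tPComp; y; z] -> dprog y f -> dprogs z gs -> dprog x (PComp f gs)
| dprog_rec x y z f g :
    N [:: x; inl tPRec; y; z] -> dprog y f -> dprog z g -> dprog x (PRec f g)
| dprog_mu x y b f : N [:: x; inl tPMu; y; b] -> dprog y f -> dprog x (PMu f)
with dprogs : value -> seq prog -> Prop :=
| dprogs_nil x a b : N [:: x; inl tNil; a; b] -> dprogs x [::]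
| dprogs_cons x y z g gs :
    N [:: x; inl tCons; y; z] -> dprog y g -> dprogs z gs -> dprogs x (g :: gs).

Variable nu : nat -> value.

(** [nu] is [inl] for cells named by constants, [inr \o posnat] for cells that the process builds
    under timestamps, and an arbitrary valuation for a match of the query. Tags are constants in all
    cases. *)
Definition image_cell (q : cell) : seq value :=
  [:: nu q.1.1.1; inl q.1.1.2; nu q.1.2; nu q.2].

Definition has_cells (s : seq cell) : Prop := forall q, q \in s -> N (image_cell q).

Lemma has_cells_cons q s : has_cells (q :: s) <-> N (image_cell q) /\ has_cells s.
Proof. by rewrite /has_cells !forall_in_foldr. Qed.

Lemma has_cells_cat s1 s2 : has_cells (s1 ++ s2) <-> has_cells s1 /\ has_cells s2.
Proof.
split=> [H|[H1 H2] q]; last by rewrite mem_cat => /orP[/H1|/H2].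
by split=> q Hq; apply: H; rewrite mem_cat Hq ?orbT.
Qed.

Lemma dprog_proj_cells i k : has_cells (proj_cells i k) -> dprog (nu (pname k)) (PProj i).
Proof.
elim: i k => [|i IH] k /= /has_cells_cons[H Hs]; first exact: dprog_head H.
exact: dprog_tail H (IH _ Hs).
Qed.

Lemma dprog_prog_cells p k : has_cells (prog_cells p k) -> dprog (nu (pname k)) p.
Proof.
elim/prog_nested_ind: p k => [||i|f gs IHf IHgs|f g IHf IHg|f IHf] k.
- by move=> /has_cells_cons[H _]; apply: dprog_zero H.
- by move=> /has_cells_cons[H /dprog_proj_cells Hq]; apply: dprog_succ H Hq.
- exact: dprog_proj_cells.
- rewrite prog_cells_comp => /has_cells_cons[H /has_cells_cat[/IHf Hf Hgs]].
  apply: dprog_comp H Hf _; move: (k.+1 + psize f) Hgs => j.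
  elim: gs IHgs j => [_ j /has_cells_cons[H _]|g gs IH [IHg IHgs] j].
    exact: dprogs_nil H.
  case/has_cells_cons=> H /has_cells_cat[/IHg Hg /(IH IHgs) Hgs].
  exact: dprogs_cons H Hg Hgs.
- move=> /has_cells_cons[H /has_cells_cat[/IHf Hf /IHg Hg]].
  exact: dprog_rec H Hf Hg.
- by move=> /has_cells_cons[H /IHf Hf]; apply: dprog_mu H Hf.
Qed.

(** [5] is [pname 0], the root of the program, and [1] is the input list. *)
Lemma has_run_cells p n : has_cells (run_cells p n) ->
  dprog (nu 5) p /\ dlist (nu 1) [:: n].
Proof.
case/has_cells_cons=> Hl /has_cells_cat[Hch].
case/has_cells_cons=> H0 /has_cells_cons[H3 /dprog_prog_cells Hp]; split=> //.
apply: dlist_cons Hl _ (dlist_nil H3).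
elim: n Hch => [_|n IH /has_cells_cons[H /IH Hn]]; first exact: dnat_zero H0.
by rewrite doubleS; apply: dnat_succ H Hn.
Qed.

End Denotation.

(** * The interpreter as Horn clauses, and their truth *)

Notation rCell := 1 (only parsing).
Notation rUsed := 2 (only parsing).
Notation rEval := 3 (only parsing).
Notation rEvals := 4 (only parsing).
Notation rMu := 5 (only parsing).
Notation rGoal := 6 (only parsing).

Definition rel_atom (r : nat) (xs : seq nat) : atom := (r, map inl xs).
Definition cell_atom (x t a b : nat) : atom :=
  (rCell, [:: inl x; inr (inl t); inl a; inl b]).

Definition clause := (nat * seq nat * seq atom)%type.

(* Variables 0, 1, 2 are the head; [rMu f v n] says that f takes positive values
   on m :: v for all m < n. *)
Definition clauses : seq clause := [::
  (rEval, [:: 0; 1; 2],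
   [:: cell_atom 0 tPZero 3 4; rel_atom rCell [:: 1; 5; 6; 7];
       cell_atom 2 tZero 8 9]);
  (rEval, [:: 0; 1; 2],
   [:: cell_atom 0 tPSucc 3 4; rel_atom rEval [:: 3; 1; 5]; cell_atom 2 tSucc 5 6]);
  (rEval, [:: 0; 1; 2], [:: cell_atom 0 tPHead 3 4; cell_atom 1 tCons 2 5]);
  (rEval, [:: 0; 1; 2],
   [:: cell_atom 0 tPHead 3 4; cell_atom 1 tNil 5 6; cell_atom 2 tZero 7 8]);
  (rEval, [:: 0; 1; 2],
   [:: cell_atom 0 tPTail 3 4; cell_atom 1 tCons 5 6; rel_atom rEval [:: 3; 6; 2]]);
  (rEval, [:: 0; 1; 2],
   [:: cell_atom 0 tPTail 3 4; cell_atom 1 tNil 5 6; cell_atom 2 tZero 7 8]);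
  (rEval, [:: 0; 1; 2],
   [:: cell_atom 0 tPComp 3 4; rel_atom rEvals [:: 4; 1; 5];
       rel_atom rEval [:: 3; 5; 2]]);
  (rEval, [:: 0; 1; 2],
   [:: cell_atom 0 tPRec 3 4; cell_atom 1 tCons 5 6; cell_atom 5 tZero 7 8;
       rel_atom rEval [:: 3; 6; 2]]);
  (rEval, [:: 0; 1; 2],
   [:: cell_atom 0 tPRec 3 4; cell_atom 1 tCons 5 6; cell_atom 5 tSucc 7 8;
       cell_atom 9 tCons 7 6; rel_atom rEval [:: 0; 9; 10];
       cell_atom 11 tCons 7 12; cell_atom 12 tCons 10 6;
       rel_atom rEval [:: 4; 11; 2]]);
  (rEval, [:: 0; 1; 2],
   [:: cell_atom 0 tPMu 3 4; rel_atom rMu [:: 3; 1; 2]; cell_atom 5 tCons 2 1;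
       rel_atom rEval [:: 3; 5; 6]; cell_atom 6 tZero 7 8]);
  (rEvals, [:: 0; 1; 2],
   [:: cell_atom 0 tNil 3 4; rel_atom rCell [:: 1; 5; 6; 7]; cell_atom 2 tNil 8 9]);
  (rEvals, [:: 0; 1; 2],
   [:: cell_atom 0 tCons 3 4; rel_atom rEval [:: 3; 1; 5];
       rel_atom rEvals [:: 4; 1; 6]; cell_atom 2 tCons 5 6]);
  (rMu, [:: 0; 1; 2],
   [:: rel_atom rCell [:: 0; 3; 4; 5]; rel_atom rCell [:: 1; 6; 7; 8];
       cell_atom 2 tZero 9 10]);
  (rMu, [:: 0; 1; 2],
   [:: cell_atom 2 tSucc 3 4; rel_atom rMu [:: 0; 1; 3]; cell_atom 5 tCons 3 1;
       rel_atom rEval [:: 0; 5; 6]; cell_atom 6 tSucc 7 8]);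
  (rGoal, [:: 0; 1],
   [:: rel_atom rEval [:: 0; 1; 2]; cell_atom 2 tSucc 3 4; cell_atom 3 tZero 5 6])].

(** The arguments are read universally, so facts about meaningless names hold vacuously; only the
    result is required to denote something. This reading is not monotone in [N], because a new cell
    may give a denotation to an argument. *)
Definition sem (N : seq value -> Prop) (f : fact) : Prop :=
  match f with
  | (rCell, l) => N l
  | (rEval, [:: p; v; y]) => forall P V, dprog N p P -> dlist N v V ->
      exists2 Y, dnat N y Y & peval P V Y
  | (rEvals, [:: g; v; w]) => forall Gs V, dprogs N g Gs -> dlist N v V ->
      exists2 W, dlist N w W & pevals Gs V W
  | (rMu, [:: f; v; n]) => forall F V, dprog N f F -> dlist N v V ->
      exists2 n', dnat N n n' &
        forall m, m < n' -> exists k, peval F (m :: V) k.+1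
  | (rGoal, [:: p; v]) => forall P V, dprog N p P -> dlist N v V -> peval P V 1
  | _ => True
  end.

Definition functional (N : seq value -> Prop) : Prop :=
  forall x l l', N (x :: l) -> N (x :: l') -> l = l'.

Ltac same_cell Nf :=
  repeat match goal with
  | H : ?N (?x :: ?l), H' : ?N (?x :: ?l') |- _ =>
      let E := fresh in
      have E := Nf _ _ _ H H'; first [discriminate E | injection E; clear E H'; intros; subst]
  end.

Notation hyp := ltac:(eassumption) (only parsing).

Ltac inv_dnat := match goal with H : dnat _ _ _ |- _ => inversion H; subst; clear H end.

Ltac inv H := inversion H; subst; clear H.

(** Functionality identifies the cell matched by a body atom with the cell from which the name gets
    its denotation. Each clause then becomes one constructor of [peval] or [pevals], or one step of
    the bounded quantifier. *)
Lemma clauses_sound N nu cl : functional N -> cl \in clauses ->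
  (forall a, a \in cl.2 -> holds_atom (sem N) nu a) ->
  sem N (cl.1.1, map nu cl.1.2).
Proof.
move=> Nf; move: cl; apply/forall_in_foldr; rewrite /clauses.
do !split; rewrite forall_in_foldr /= /holds_atom /=.
- move=> [Hp [_ [Hy _]]] P V dP dV; inv dP; same_cell Nf.
  by exists 0; [apply: dnat_zero Hy | constructor].
- move=> [Hp [He [Hy _]]] P V dP dV; inv dP; same_cell Nf.
  have [Y dY] := He _ _ hyp dV => E; inv E.
  by exists (nth 0 V 0).+1; [apply: dnat_succ Hy dY | constructor].
- move=> [Hp [Hv _]] P V dP dV; inv dP; same_cell Nf.
  inv dV; same_cell Nf.
  by eexists; [eassumption | apply: (ev_proj 0)].
- move=> [Hp [Hv [Hy _]]] P V dP dV; inv dP; same_cell Nf.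
  inv dV; same_cell Nf.
  by exists 0; [apply: dnat_zero Hy | apply: (ev_proj 0)].
- move=> [Hp [Hv [He _]]] P V dP dV; inv dP; same_cell Nf.
  inv dV; same_cell Nf.
  have [Y dY] := He _ _ hyp hyp => E; inv E.
  by eexists; [eassumption | apply: (ev_proj i.+1)].
- move=> [Hp [Hv [Hy _]]] P V dP dV; inv dP; same_cell Nf.
  inv dV; same_cell Nf.
  by exists 0; [apply: dnat_zero Hy | apply: (ev_proj i.+1)].
- move=> [Hp [Hg [Hf _]]] P V dP dV; inv dP; same_cell Nf.
  have [W dW eW] := Hg _ _ hyp dV.
  have [Y dY eY] := Hf _ _ hyp dW.
  by exists Y => //; apply: ev_comp eW eY.
- move=> [Hp [Hv [Hn [He _]]]] P V dP dV; inv dP; same_cell Nf.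
  inv dV; same_cell Nf; inv_dnat; same_cell Nf.
  have [Y dY eY] := He _ _ hyp hyp.
  by exists Y => //; apply: ev_rec0.
- move=> [Hp [Hv [Hn [Hv1 [Hz [Hv2 [Hv3 [Hy _]]]]]]]] P V dP dV.
  move: (dP) => dP'; inv dP; same_cell Nf.
  inv dV; same_cell Nf; inv_dnat; same_cell Nf.
  have [Z dZ eZ] := Hz _ _ dP' (dlist_cons Hv1 hyp hyp).
  have [Y dY eY] := Hy _ _ hyp (dlist_cons Hv2 hyp (dlist_cons Hv3 dZ hyp)).
  by exists Y => //; apply: ev_recS eZ eY.
- move=> [Hp [Hm [Hl [He [Hz _]]]]] P V dP dV; inv dP; same_cell Nf.
  have [m dm eM] := Hm _ _ hyp dV.
  have [Z dZ eZ] := He _ _ hyp (dlist_cons Hl dm dV).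
  by inv dZ; same_cell Nf; exists m => //; apply: ev_mu.
- move=> [Hg [_ [Hw _]]] G V dG dV; inv dG; same_cell Nf.
  by exists [::]; [apply: dlist_nil Hw | constructor].
- move=> [Hg [He [Hs [Hw _]]]] G V dG dV; inv dG; same_cell Nf.
  have [Y dY eY] := He _ _ hyp dV.
  have [W dW eW] := Hs _ _ hyp dV.
  by exists (Y :: W); [apply: dlist_cons Hw dY dW | constructor].
- by move=> [_ [_ [Hn _]]] F V dF dV; exists 0; first exact: dnat_zero Hn.
- move=> [Hn [Hm [Hl [He [Hz _]]]]] F V dF dV.
  have [m dm eM] := Hm _ _ dF dV.
  have [Z dZ eZ] := He _ _ dF (dlist_cons Hl dm dV).
  inv dZ; same_cell Nf; exists m.+1; first exact: dnat_succ Hn dm.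
  move=> k; rewrite ltnS leq_eqVlt => /orP[/eqP->|/eM //].
  by eexists; eassumption.
- move=> [He [Hy [Hz _]]] P V dP dV.
  have [Y dY eY] := He _ _ dP dV.
  by inv dY; same_cell Nf; inv_dnat; same_cell Nf.
Qed.

(** * The process *)

Definition posnat (k : nat) : posrat := Sub (k.+1%:R : rat)%R (ltr0Sn rat k).

Lemma inr_posnat_inj i j : inr (posnat i) = inr (posnat j) :> value -> i = j.
Proof.
move=> /(congr1 (fun v : value => if v is inr r then val r else 0%R)) /= /eqP.
by rewrite eqr_nat => /eqP[].
Qed.

Definition in_atom : atom := rel_atom In_sym [:: 0; 1; 2; 3; 4].
Definition record_body : body := ([:: in_atom], [::], [::]).
Definition cell_rule : rule := (rCell, [:: 0; 1; 2; 3], record_body).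
Definition used_rule : rule := (rUsed, [:: 0], record_body).
Definition no_condition : body := ([::], [::], [::]).

Notation atStart := 0 (only parsing).
Notation atClaimed := 1 (only parsing).
Notation atLoad := 2 (only parsing).
Notation atEnd := 3 (only parsing).

(** The instance serves only as a trigger: the body is matched against the database, and the rule
    adds the consequences of all matches at once. *)
Definition clause_trans (cl : clause) : transition :=
  (atStart, atEnd, no_condition, (cl.1, (cl.2, [::], [::]))).

(* Claiming a name marks it as used, so that each timestamp names at most one
   cell; the claimed names are timestamps, hence never clash with constants. *)
Definition claim_trans : transition :=
  (atStart, atClaimed,
   ([:: in_atom], [:: rel_atom rUsed [:: 0]], [:: (0, posnat 0, (false, false))]),
   used_rule).

Definition write_trans : transition := (atClaimed, atEnd, no_condition, cell_rule).
(** No transition leads to [atLoad] and no instance starts there, so only the records of the initial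
    instances are written unchecked. *)
Definition load_trans : transition := (atLoad, atEnd, no_condition, cell_rule).

(** The head of a rule holds variables only. The constants of the cell are therefore tested in the
    condition, and the matching record is copied. *)
Definition const_trans (q : cell) : transition :=
  (atStart, atEnd,
   ([:: (In_sym, [:: inr (inl q.1.1.1); inr (inl q.1.1.2); inr (inl q.1.2);
                     inr (inl q.2); inl 0])], [::], [::]),
   cell_rule).

Definition interp_schema : schema :=
  [:: (rCell, 4); (rUsed, 1); (rEval, 3); (rEvals, 3); (rMu, 3); (rGoal, 2)].

Definition process_of_trans (ts : seq transition) : process :=
  (interp_schema, 4, [:: atStart; atClaimed; atLoad; atEnd], atStart, ts).

Definition interp_trans : seq transition :=
  map clause_trans clauses ++ [:: claim_trans; write_trans; load_trans].

Definition interp (s : seq cell) : process :=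
  process_of_trans (map const_trans s ++ interp_trans).

Definition const_fact (q : cell) : fact := (rCell, image_cell inl q).
Definition const_inst (q : cell) : nat * record :=
  (atLoad, (image_cell inl q, posnat 0)).

Definition cells_of (D : dbset) : seq value -> Prop := fun w => D (rCell, w).

Variant interp_trans_spec (s : seq cell) : transition -> Prop :=
| InterpConst q of q \in s : interp_trans_spec s (const_trans q)
| InterpClause cl of cl \in clauses : interp_trans_spec s (clause_trans cl)
| InterpClaim : interp_trans_spec s claim_trans
| InterpWrite : interp_trans_spec s write_trans
| InterpLoad : interp_trans_spec s load_trans.

Lemma interp_transP s t : t \in p_trans (interp s) -> interp_trans_spec s t.
Proof.
rewrite /= /interp_trans !mem_cat.
case/or3P=> [/mapP[q Hq ->]|/mapP[cl Hcl ->]|]; first exact: InterpConst.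
  exact: InterpClause.
by rewrite !inE => /or3P[]/eqP->; constructor.
Qed.

Lemma mem_interp_trans s t :
  t \in [:: claim_trans; write_trans; load_trans] -> t \in p_trans (interp s).
Proof.
move=> Ht; have -> : p_trans (interp s) = map const_trans s ++ interp_trans by [].
by rewrite mem_cat [X in _ || X]mem_cat Ht !orbT.
Qed.

Lemma interp_acyclic s : acyclic (interp s).
Proof.
move=> p; suff H x y : clos_trans nat (edge (interp s)) x y -> x < y.
  by move/H; rewrite ltnn.
elim=> {x y} [x y [t /interp_transP Ht [<- <-]]|x y z _ xy _ yz]; last lia.
by case: Ht.
Qed.

Lemma inj_in_of_uniq_map (T U : eqType) (f : T -> U) (s : seq T) :
  uniq (map f s) -> {in s &, injective f}.
Proof.
elim: s => [_ x y //|z s IH /= /andP[Hz Us] x y].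
rewrite !inE => /orP[/eqP->|Hx] /orP[/eqP->|Hy] E //; last exact: IH.
  by case/negP: Hz; rewrite E map_f.
by case/negP: Hz; rewrite -E map_f.
Qed.

(** * Soundness: every derived goal is true *)

Section Soundness.
Variables (s1 s2 s3 s : seq cell).
Hypothesis s1s : {subset s1 <= s}.
Hypothesis s2s : {subset s2 <= s}.
Hypothesis s3s : {subset s3 <= s}.
Hypothesis s_uniq : uniq (map cname s).

Let init : config := Cfg (map const_inst s2) (db_of (map const_fact s3)) (posnat 0).

Definition static (w : seq value) : Prop := exists2 q, q \in s & w = image_cell inl q.

(** A record waiting at [atClaimed] counts as well, since uniqueness of names has to survive between
    claim and write. *)
Definition candidate (C : config) (w : seq value) : Prop :=
  c_db C (rCell, w) \/ exists tau, (atClaimed, (w, tau)) \in c_inst C.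

Record cells_inv (C : config) : Prop := CellsInv {
  no_In_fact : forall f, c_db C f -> f.1 != In_sym;
  candidate_named : forall w, candidate C w ->
    static w \/ exists r l, w = inr r :: l /\ c_db C (rUsed, [:: inr r]);
  candidate_unique : forall r l l',
    candidate C (inr r :: l) -> candidate C (inr r :: l') -> l = l';
  load_static : forall r, (atLoad, r) \in c_inst C -> static r.1 }.

(** Without stored [In] facts the [In] atom can only match the record of the moving instance. The
    length of [r.1] is unknown, so the data is recovered by cutting the timestamp off the end. *)
Lemma rule_out_record (D : dbset) r R xs f :
  (forall f, D f -> f.1 != In_sym) ->
  rule_out (fun f => D f \/ f = In_fact r) (R, xs, record_body) f ->
  exists2 nu, f = (R, map nu xs) & r.1 = [:: nu 0; nu 1; nu 2; nu 3].
Proof.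
move=> Din; case: f => R' l [/= -> [nu [[/(_ in_atom (mem_head _ _)) H _] ->]]].
exists nu => //; case: H => [/Din //|[]].
by rewrite cats1 -[X in X = _ -> _]/(rcons [:: nu 0; nu 1; nu 2; nu 3] (nu 4)) => /rcons_inj[->].
Qed.

Lemma cells_inv_init : cells_inv init.
Proof.
have Hst w : c_db init (rCell, w) -> static w.
  by case/mapP=> q /s3s Hq [->]; exists q.
have Hc w : candidate init w -> static w.
  by case=> [/Hst //|[tau]] /mapP[].
split.
- by move=> f /mapP[q _ ->].
- by move=> w /Hc; left.
- by move=> r l l' /Hc[].
- by move=> r /mapP[q /s2s Hq [->]]; exists q.
Qed.

(** A write turns a waiting candidate into a stored one, and the other sources of cells are static.
    Only a claim adds a candidate named by a timestamp, and that name was unmarked before. *)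
Lemma cells_inv_step C C' : step (interp s1) C C' -> cells_inv C -> cells_inv C'.
Proof.
case=> [i1 i2 q r t D tau /interp_transP Ht Eq D1 HE|I D tau cs tau' _ _] Inv; last first.
  have Hc w : candidate (Cfg (I ++ [:: (atStart, (cs, tau'))]) D tau') w ->
      candidate (Cfg I D tau) w.
    case=> [H|[t /=]]; first by left.
    by rewrite mem_cat inE => /orP[H|//]; right; exists t.
  case: Inv => Inv1 Inv2 Inv3 Inv4; split=> //=.
  - by move=> w /Hc /Inv2.
  - by move=> r' l l' /Hc H /Hc; apply: Inv3.
  - by move=> r'; rewrite mem_cat inE => /orP[/Inv4|].
case: Inv => Inv1 Inv2 Inv3 Inv4.
have mem_i o p : p != t_tgt t ->
    (p, o) \in i1 ++ (t_tgt t, r) :: i2 -> (p, o) \in i1 ++ (q, r) :: i2.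
  move=> pq; rewrite !mem_cat !inE !xpair_eqE (negbTE pq) /=.
  by case/orP=> ->; rewrite ?orbT.
(* All transitions but the claim keep the candidates: their new cells come from
   a static cell or from a claimed record. *)
have keep : t_tgt t != atClaimed -> t_tgt t != atLoad -> (t_W t).1.1 != In_sym ->
    (forall w, rule_out D1 (t_W t) (rCell, w) ->
       static w \/ candidate (Cfg (i1 ++ (q, r) :: i2) D tau) w) ->
    cells_inv (Cfg (i1 ++ (t_tgt t, r) :: i2)
                   (fun f => D f \/ rule_out D1 (t_W t) f) tau).
  move=> t1 t2 tW Hout.
  have Hc w : candidate (Cfg (i1 ++ (t_tgt t, r) :: i2)
      (fun f => D f \/ rule_out D1 (t_W t) f) tau) w ->
      static w \/ candidate (Cfg (i1 ++ (q, r) :: i2) D tau) w.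
    case=> [[H|/Hout //]|[tau' /mem_i H]]; first by right; left.
    by right; right; exists tau'; apply: H; rewrite eq_sym.
  have Hs r' l : ~ static (inr r' :: l) by case.
  split=> /=.
  - by move=> f [/Inv1 //|[-> _]].
  - move=> w /Hc[|/Inv2[|[r' [l [-> H]]]]]; [by left | by left | right].
    by exists r', l; split=> //; left.
  - move=> r' l l' /Hc[/Hs //|H] /Hc[/Hs //|]; exact: Inv3 H.
  - by move=> r' /mem_i H; apply/Inv4/H; rewrite eq_sym.
rewrite {}/D1 in HE keep *.
case: Ht Eq HE keep mem_i => /=.
- move=> c Hc Eq HE keep _; apply: keep => // w H; left.
  have [nu [->] Er] := rule_out_record Inv1 H; exists c; first exact: s1s.
  case: HE => nu' [HIn _].
  case: (HIn _ (mem_head _ _)) => [/Inv1 //|[]].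
  rewrite cats1 -[X in X = _ -> _]/(rcons (image_cell inl c) (nu' 0)).
  by move=> /rcons_inj[-> _]; rewrite Er.
- move=> cl Hcl _ _ keep _; apply: keep => //.
    exact: (allP (isT : all (fun cl : clause => cl.1.1 != In_sym) clauses)) Hcl.
  move=> w [E _].
  have := allP (isT : all (fun cl : clause => cl.1.1 != rCell) clauses) _ Hcl.
  by rewrite -E.
- move=> Eq HE _ mem_i.
  case: HE => nu [HIn [HnU Hcmp]].
  case: (HIn _ (mem_head _ _)) => [/Inv1 //|[]].
  rewrite cats1 -[X in X = _ -> _]/(rcons [:: nu 0; nu 1; nu 2; nu 3] (nu 4)).
  move=> /rcons_inj[Er E4].
  have nU := HnU _ (mem_head _ _).
  have := Hcmp _ (mem_head _ _).
  (* The comparison is false on constants, so the claimed name is a timestamp. *)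
  rewrite /holds_cmp /=; case E0: (nu 0) => [//|r0] _.
  have {}nU : ~ D (rUsed, [:: inr r0]).
    by move=> H; apply: nU; left; rewrite /= E0.
  have Hu f : rule_out (fun f => D f \/ f = In_fact r) used_rule f -> f = (rUsed, [:: inr r0]).
    by case/(rule_out_record Inv1) => nu' ->; rewrite -Er /= E0 => -[-> _ _ _].
  set C1 := Cfg _ _ _.
  have HU : c_db C1 (rUsed, [:: inr r0]).
    right; split=> //; exists nu; split; last by rewrite /= E0.
    split=> [a|]; last by split.
    by rewrite inE => /eqP->; right; rewrite /holds_atom /In_fact -Er -E4.
  have Hc w : candidate C1 w ->
      candidate (Cfg (i1 ++ (q, r) :: i2) D tau) w \/ w = r.1.
    case=> [[H|/Hu //]|[tau' /=]]; first by left; left.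
    rewrite mem_cat inE xpair_eqE /= => /or3P[H|/eqP E|H]; last 1 first.
    + by left; right; exists tau'; rewrite mem_cat inE H !orbT.
    + by left; right; exists tau'; rewrite mem_cat H.
    + by right; rewrite -E.
  (* The name of an earlier candidate is a constant or a marked timestamp, and [r0] is neither. *)
  have old l : ~ candidate (Cfg (i1 ++ (q, r) :: i2) D tau) (inr r0 :: l).
    by move=> /Inv2[[]|[r' [l' [[<- _] /nU]]]].
  split=> /=.
  + by move=> f [/Inv1 //|/Hu ->].
  + move=> w /Hc[/Inv2[|[r' [l [-> H]]]]|->]; first by left.
      by right; exists r', l; split=> //; left.
    by right; rewrite -Er E0; do 2 eexists; split; first reflexivity.
  + move=> r' l l' /Hc[H|El] /Hc[H'|El'].
    * exact: Inv3 H H'.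
    * by move: H; rewrite -Er E0 in El'; case: El' => -> _ /old.
    * by move: H'; rewrite -Er E0 in El; case: El => -> _ /old.
    * by move: El; rewrite -El' => -[].
  + by move=> r' /mem_i H; apply/Inv4/H.
- move=> Eq _ keep _; apply: keep => // w H; right; right.
  have [nu [->] Er] := rule_out_record Inv1 H; exists r.2.
  by rewrite -Er -Eq -surjective_pairing mem_cat mem_head orbT.
- move=> Eq _ keep _; apply: keep => // w H; left.
  have [nu [->] Er] := rule_out_record Inv1 H; rewrite -Er.
  by apply: Inv4; rewrite /= -Eq mem_cat mem_head orbT.
Qed.

Lemma reaches_sub P C C' : reaches P C C' -> forall f, c_db C f -> c_db C' f.
Proof.
elim=> {C C'} [C C' [] *|//|C1 C2 C3 _ H1 _ H2 f /H1/H2 //]; last by [].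
by left.
Qed.

Lemma cells_inv_reach C C' :
  reaches (interp s1) C C' -> cells_inv C -> cells_inv C'.
Proof.
by elim=> {C C'} [C C' /cells_inv_step //|//|C1 C2 C3 _ H1 _ H2 /H1/H2].
Qed.

(* The cells are taken from the end of the execution: a cell written late could
   otherwise give a meaning to facts derived before. *)
Lemma sem_reach N C C' : functional N -> reaches (interp s1) C C' ->
  (forall w, c_db C' (rCell, w) -> N w) ->
  (forall f, c_db C f -> sem N f) -> forall f, c_db C' f -> sem N f.
Proof.
move=> Nf; elim=> {C C'} [C C'|//|C1 C2 C3 R12 H12 R23 H23 HN H1]; last first.
  by apply: H23 => //; apply: H12 => // w /(reaches_sub R23)/HN.
case=> [i1 i2 q r t D tau /interp_transP Ht _ /= _ HN HD f|//] [/HD //|].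
have cell_sem R w : R = rCell \/ R = rUsed ->
    rule_out (fun f => D f \/ f = In_fact r) (R, w, record_body) f ->
    (forall l, f = (rCell, l) -> N l) -> sem N f.
  by case: f => R' l [-> [/= -> _] H|-> [/= -> _] //]; apply: H.
case: Ht HN => [c _|cl Hcl|||] HN Hf.
- by apply: cell_sem (Hf) _; [left | move=> l El; apply: HN; right; rewrite -El].
- case: f Hf {cell_sem} => R l [/= -> [nu [[Hpos _] ->]]]; apply: clauses_sound => // a Ha.
  by case: (Hpos a Ha) => [/HD //|]; rewrite /holds_atom => ->.
- by apply: cell_sem (Hf) _; [right | move=> l El; case: Hf; rewrite El].
- by apply: cell_sem (Hf) _; [left | move=> l El; apply: HN; right; rewrite -El].
- by apply: cell_sem (Hf) _; [left | move=> l El; apply: HN; right; rewrite -El].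
Qed.

Lemma interp_sound C : reaches (interp s1) init C ->
  exists N, [/\ has_cells N inl s, forall w, c_db C (rCell, w) -> N w &
    forall x l p v, c_db C (rGoal, [:: x; l]) ->
      dprog N x p -> dlist N l v -> peval p v 1].
Proof.
move=> R; have Inv := cells_inv_reach R cells_inv_init.
(* The store contains the given cells whether or not they have been loaded, together with all cells
   present at the end. *)
pose N w := static w \/ c_db C (rCell, w).
have Nf : functional N.
  have Hst x l l' : static (x :: l) -> static (x :: l') -> l = l'.
    move=> [q Hq [-> ->]] [q' Hq' [E ->]].
    suff -> : q = q' by [].
    by apply: (inj_in_of_uniq_map s_uniq).
  have Hdb x l l' : static (x :: l) -> c_db C (rCell, x :: l') -> l = l'.
    move=> H H'.
    have [|[r [l0 [[Ex _] _]]]] := candidate_named Inv (or_introl H'); first exact: Hst.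
    by rewrite Ex in H; case: H.
  move=> x l l' [H|H] [H'|H'].
  - exact: Hst H'.
  - exact: Hdb H'.
  - by apply/esym/Hdb; eassumption.
  - have [Hs|[r [l0 [[Ex _] _]]]] := candidate_named Inv (or_introl H).
      exact: Hdb H'.
    by rewrite Ex in H H'; apply: (candidate_unique Inv); left; eassumption.
exists N; split=> [q Hq|w Hw|x l p v Hg]; [by left; exists q | by right |].
suff: sem N (rGoal, [:: x; l]) by apply.
apply: (sem_reach Nf R) Hg => [w Hw|f]; first by right.
by case/mapP=> q /s3s Hq ->; left; exists q.
Qed.

End Soundness.

(** * Completeness: every evaluation can be derived *)

Section Mono.
Variables (N N' : seq value -> Prop).
Hypothesis NN' : forall w, N w -> N' w.

Lemma dnat_mono x n : dnat N x n -> dnat N' x n.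
Proof.
by elim=> [y a b /NN' H|y z b m /NN' H _ IH]; [exact: dnat_zero H | exact: dnat_succ H IH].
Qed.

Lemma dlist_mono x v : dlist N x v -> dlist N' x v.
Proof.
elim=> [y a b /NN' H|y h t n w /NN' H /dnat_mono Hn _ IH]; first exact: dlist_nil H.
exact: dlist_cons H Hn IH.
Qed.

Fixpoint dprog_mono x p (H : dprog N x p) {struct H} : dprog N' x p :=
  match H with
  | dprog_zero _ _ _ Hx => dprog_zero (NN' Hx)
  | dprog_succ _ _ _ Hx Hq => dprog_succ (NN' Hx) (dprog_mono Hq)
  | dprog_head _ _ _ Hx => dprog_head (NN' Hx)
  | dprog_tail _ _ _ _ Hx Hq => dprog_tail (NN' Hx) (dprog_mono Hq)
  | dprog_comp _ _ _ _ _ Hx Hf Hg =>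
      dprog_comp (NN' Hx) (dprog_mono Hf) (dprogs_mono Hg)
  | dprog_rec _ _ _ _ _ Hx Hf Hg =>
      dprog_rec (NN' Hx) (dprog_mono Hf) (dprog_mono Hg)
  | dprog_mu _ _ _ _ Hx Hf => dprog_mu (NN' Hx) (dprog_mono Hf)
  end
with dprogs_mono x gs (H : dprogs N x gs) {struct H} : dprogs N' x gs :=
  match H with
  | dprogs_nil _ _ _ Hx => dprogs_nil (NN' Hx)
  | dprogs_cons _ _ _ _ _ Hx Hg Hgs =>
      dprogs_cons (NN' Hx) (dprog_mono Hg) (dprogs_mono Hgs)
  end.

End Mono.

Lemma dlist_cell N x v : dlist N x v -> exists t a b, N [:: x; t; a; b].
Proof. by case=> *; do 3 eexists; eassumption. Qed.

Lemma dprog_cell N x p : dprog N x p -> exists t a b, N [:: x; t; a; b].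
Proof. by case=> *; do 3 eexists; eassumption. Qed.

Section Completeness.
Variable s : seq cell.

(** All but finitely many of the names [posnat k] are unclaimed, so a fresh one is always
    available. *)
Definition ready (C : config) : Prop :=
  (forall f, c_db C f -> f.1 != In_sym) /\
  exists K, forall k, K <= k -> ~ c_db C (rUsed, [:: inr (posnat k)]).

Definition grows (C C' : config) : Prop :=
  [/\ reaches (interp s) C C', forall f, c_db C f -> c_db C' f & ready C'].

Definition can (C : config) (G : dbset -> Prop) : Prop :=
  exists2 C', grows C C' & G (c_db C').

Lemma can_now C (G : dbset -> Prop) : ready C -> G (c_db C) -> can C G.
Proof. by exists C => //; split=> //; apply: rt_refl. Qed.

Lemma grows_can C C1 (G : dbset -> Prop) : grows C C1 -> can C1 G -> can C G.
Proof.
move=> [R1 S1 _] [C2 [R2 S2 K2] G2]; exists C2 => //; split=> //.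
  exact: rt_trans R1 R2.
by move=> f /S1/S2.
Qed.

Lemma can_bind C (G H : dbset -> Prop) :
  can C G -> (forall C', grows C C' -> G (c_db C') -> can C' H) -> can C H.
Proof. by case=> C1 G1 HG HH; apply: grows_can G1 (HH C1 G1 HG). Qed.

(** The new instance starts at the current time, so time does not advance and such steps can be
    repeated at will. *)
Lemma reach_fire C t cs :
  t \in p_trans (interp s) -> t_src t = atStart -> size cs = 4 ->
  let D1 f := c_db C f \/ f = In_fact (cs, c_time C) in
  sat_bool D1 (t_E t) ->
  reaches (interp s) C
    (Cfg (c_inst C ++ [:: (t_tgt t, (cs, c_time C))])
         (fun f => c_db C f \/ rule_out D1 (t_W t) f) (c_time C)).
Proof.
case: C => I D tau Ht Es Hcs D1 HE; apply: rt_trans; last first.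
  by apply: rt_step; apply: (step_traverse I [::] tau Ht Es); exact: HE.
by apply: rt_step; apply: step_start.
Qed.

Lemma fire_clause i (vs : seq value) C :
  let cl := nth (0, [::], [::]) clauses i in
  i < size clauses -> ready C ->
  foldr (fun a => and (holds_atom (c_db C) (nth (inl 0) vs) a)) True cl.2 ->
  can C (fun D => D (cl.1.1, map (nth (inl 0) vs) cl.1.2)).
Proof.
move=> cl Hi [HI [K HK]] /forall_in_foldr Hb.
have Hcl : cl \in clauses by apply: mem_nth.
have Ht : clause_trans cl \in p_trans (interp s).
  by rewrite /= /interp_trans !mem_cat map_f ?orbT.
pose nu := nth (inl 0 : value) vs.
have R := @reach_fire C _ (nseq 4 (inl 0)) Ht erefl erefl.
eexists; first split.
- by apply: R; exists nu; split.
- by left.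
- split=> [f /= [/HI //|[-> _]]|].
    exact: (allP (isT : all (fun cl : clause => cl.1.1 != In_sym) clauses)) Hcl.
  exists K => k /HK Hk [/Hk //|[/= E _]].
  by have := allP (isT : all (fun cl : clause => cl.1.1 != rUsed) clauses) _ Hcl; rewrite -E.
right; split=> //; exists nu; split=> //; split=> // a /Hb; by left.
Qed.

Lemma create_cell C k (w : seq value) :
  (forall f, c_db C f -> f.1 != In_sym) -> size w = 3 ->
  ~ c_db C (rUsed, [:: inr (posnat k)]) ->
  exists C', [/\ reaches (interp s) C C', forall f, c_db C f -> c_db C' f,
    c_db C' (rCell, inr (posnat k) :: w), forall f, c_db C' f -> f.1 != In_sym &
    forall x, c_db C' (rUsed, [:: x]) ->
      c_db C (rUsed, [:: x]) \/ x = inr (posnat k)].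
Proof.
case: w => [|t [|a [|b [|//]]]] // HI _ nU.
have Ht : claim_trans \in p_trans (interp s).
  by apply: mem_interp_trans; rewrite !inE eqxx ?orbT.
pose cs : seq value := [:: inr (posnat k); t; a; b].
pose nu : valuation := nth (inl 0) (cs ++ [:: inr (c_time C)]).
have R := @reach_fire C _ cs Ht erefl erefl.
set D1 := fun f => c_db C f \/ f = In_fact (cs, c_time C) in R.
have HIn D : D (In_fact (cs, c_time C)) -> holds_body D nu record_body.
  by move=> H; split=> [c|]; [rewrite inE => /eqP-> | split].
have {}R : reaches (interp s) C
    (Cfg (c_inst C ++ [:: (atClaimed, (cs, c_time C))])
         (fun f => c_db C f \/ rule_out D1 used_rule f) (c_time C)).
  apply: R; exists nu; split; last split.
  - by have [] := HIn D1 (or_intror erefl).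
  - by move=> c; rewrite inE => /eqP-> [].
  (* [posnat k] is [k + 1], hence at least the bound [posnat 0], which is 1. *)
  - move=> c; rewrite inE => /eqP->; rewrite /holds_cmp /=.
    by rewrite ler_nat.
set D2 := (fun f => _ \/ _) in R.
have HI2 f : D2 f -> f.1 != In_sym by case=> [/HI //|[-> _]].
have Hw : write_trans \in p_trans (interp s).
  by apply: mem_interp_trans; rewrite !inE eqxx ?orbT.
eexists; split.
- apply: rt_trans R _; apply: rt_step.
  apply: (step_traverse _ [::] _ Hw) => //.
  by exists nu; split.
- by move=> f Hf; left; left.
- by right; split=> //; exists nu; split; [apply: HIn; right | ].
- by move=> f /= [/HI2 //|[-> _]].
- move=> x /= [[|]|[//]]; first by left.
  case/(rule_out_record HI) => nu' [->] /= [<- _ _ _]; by right.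
Qed.

Lemma create_cells C (cs : seq cell) : ready C ->
  (forall k, ~ c_db C (rUsed, [:: inr (posnat k)])) -> uniq (map cname cs) ->
  can C (fun D => has_cells (cells_of D) (inr \o posnat) cs).
Proof.
move=> [HI _] HU Hu.
suff [C' [R S H HI' HU']] : exists C', [/\ reaches (interp s) C C',
    forall f, c_db C f -> c_db C' f,
    has_cells (cells_of (c_db C')) (inr \o posnat) cs,
    forall f, c_db C' f -> f.1 != In_sym &
    forall k, c_db C' (rUsed, [:: inr (posnat k)]) -> k \in map cname cs].
  (* The sum of the claimed names bounds each of them. *)
  exists C' => //; split=> //; split=> //; exists (sumn (map cname cs)).+1 => k Hk.
  move=> /HU'; elim: (map _ _) Hk => //= j l IH Hk; rewrite inE => /orP[/eqP E|]; first lia.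
  by apply: IH; lia.
elim: cs Hu => [_|q cs IH /= /andP[Hq /IH [C1 [R1 S1 H1 HI1 HU1]]]].
  by exists C; split=> //; [exact: rt_refl | move=> k /HU].
have nU : ~ c_db C1 (rUsed, [:: inr (posnat (cname q))]).
  by move=> /HU1; rewrite (negbTE Hq).
have [C2 [R2 S2 H2 HI2 HU2]] := @create_cell C1 _
  [:: inl q.1.1.2; inr (posnat q.1.2); inr (posnat q.2)] HI1 erefl nU.
exists C2; split=> //.
- exact: rt_trans R1 R2.
- by move=> f /S1/S2.
- by apply/has_cells_cons; split=> // q' /H1; apply: S2.
- move=> k /HU2[/HU1|/inr_posnat_inj->]; rewrite inE ?eqxx //.
  by move->; rewrite orbT.
Qed.

Lemma can_cell C t a b : ready C ->
  can C (fun D => exists x, cells_of D [:: x; inl t; a; b]).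
Proof.
move=> [HI [K HK]].
have [C' [R S H HI' HU']] := @create_cell C K [:: inl t; a; b] HI erefl (HK _ (leqnn _)).
exists C'; last by eexists; apply: H.
split=> //; split=> //; exists K.+1 => k Hk /HU'[/HK|/inr_posnat_inj]; last lia.
by apply; lia.
Qed.

Lemma grows_cells C C' : grows C C' ->
  forall w, cells_of (c_db C) w -> cells_of (c_db C') w.
Proof. by case=> _ S _ w; apply: S. Qed.

Lemma grows_ready C C' : grows C C' -> ready C'.
Proof. by case. Qed.

(** [i] is the position in [clauses], and [vs] lists the values of the variables in order, so that
    the body computes to a concrete conjunction. *)
Lemma can_fire i (vs : seq value) C (G : dbset -> Prop) :
  let cl := nth (0, [::], [::]) clauses i in
  i < size clauses -> ready C ->
  foldr (fun a => and (holds_atom (c_db C) (nth (inl 0) vs) a)) True cl.2 ->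
  (forall C', grows C C' -> c_db C' (cl.1.1, map (nth (inl 0) vs) cl.1.2) ->
     G (c_db C')) ->
  can C G.
Proof.
move=> cl Hi rC Hb HG; apply: can_bind (fire_clause Hi rC Hb) _ => C' GC' H.
by apply: can_now (grows_ready GC') (HG _ GC' H).
Qed.

Definition evaluates (x l : value) (y : nat) (D : dbset) : Prop :=
  exists2 z, dnat (cells_of D) z y & D (rEval, [:: x; l; z]).

(** Quantifying over all ready configurations lets an induction hypothesis be used after the
    database has grown. *)
Definition can_eval (p : prog) (v : seq nat) (y : nat) : Prop :=
  forall C x l, ready C ->
    dprog (cells_of (c_db C)) x p -> dlist (cells_of (c_db C)) l v ->
    can C (evaluates x l y).

Definition can_evals (gs : seq prog) (v ws : seq nat) : Prop :=
  forall C x l, ready C ->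
    dprogs (cells_of (c_db C)) x gs -> dlist (cells_of (c_db C)) l v ->
    can C (fun D =>
      exists2 z, dlist (cells_of D) z ws & D (rEvals, [:: x; l; z])).

Lemma can_eval_proj i v : can_eval (PProj i) v (nth 0 v i).
Proof.
elim: i v => [|i IH] v C x l rC dx dl; inversion dx as [| |? a b Hx|? q b ? Hx dq| | |]; subst.
  case: l v / dl => [l a' b' Hl|l h t n v Hl dh dt].
    apply: can_bind (can_cell tZero (inl 0) (inl 0) rC) _ => C1 G1 [z Hz].
    apply: (can_fire (i := 3) (vs := [:: x; l; z; a; b; a'; b'; inl 0; inl 0])) => //.
    - exact: grows_ready G1.
    - by do !split=> //; apply: (grows_cells G1).
    - by move=> C2 G2 H2; exists z => //; apply: dnat_zero (grows_cells G2 Hz).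
  apply: (can_fire (i := 2) (vs := [:: x; l; h; a; b; t])) => // C1 G1 H1.
  by exists h => //; apply: dnat_mono (grows_cells G1) _ _ dh.
case: l v / dl => [l a' b' Hl|l h t n v Hl dh dt].
  apply: can_bind (can_cell tZero (inl 0) (inl 0) rC) _ => C1 G1 [z Hz].
  apply: (can_fire (i := 5) (vs := [:: x; l; z; q; b; a'; b'; inl 0; inl 0])) => //.
  - exact: grows_ready G1.
  - by do !split=> //; apply: (grows_cells G1).
  - by move=> C2 G2 H2; exists z => //; apply: dnat_zero (grows_cells G2 Hz).
apply: can_bind (IH v _ _ _ rC dq dt) _ => C1 G1 [z dz Hz].
apply: (can_fire (i := 4) (vs := [:: x; l; z; q; b; h; t])) => //.
- exact: grows_ready G1.
- by do !split=> //; apply: (grows_cells G1).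
- by move=> C2 G2 H2; exists z => //; apply: dnat_mono (grows_cells G2) _ _ dz.
Qed.

Lemma can_eval_mu f v n :
  can_eval f (n :: v) 0 ->
  (forall m, m < n -> exists k, can_eval f (m :: v) k.+1) ->
  can_eval (PMu f) v n.
Proof.
move=> IH0 IHS C x l rC dx dl; inversion dx as [| | | | | |? y b ? Hx dy]; subst.
(* The bounded quantifier is derived one value at a time; each value needs a new list cell and a new
   numeral. *)
have Hmu m : m <= n -> can C (fun D =>
    exists2 z, dnat (cells_of D) z m & D (rMu, [:: y; l; z])).
  elim: m => [_|m IH mn].
    apply: can_bind (can_cell tZero (inl 0) (inl 0) rC) _ => C1 G1 [z Hz].
    have [t [a [a' /(grows_cells G1) Hl]]] := dlist_cell dl.
    have [t' [c [c' /(grows_cells G1) Hy]]] := dprog_cell dy.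
    apply: (can_fire (i := 12)
      (vs := [:: y; l; z; t'; c; c'; t; a; a'; inl 0; inl 0])) => //.
      exact: grows_ready G1.
    by move=> C2 G2 H2; exists z => //; apply: dnat_zero (grows_cells G2 Hz).
  apply: can_bind (IH (ltnW mn)) _ => C1 G1 [z dz Hz].
  apply: can_bind (can_cell tCons z l (grows_ready G1)) _ => C2 G2 [w Hw].
  have [k Hk] := IHS m mn.
  have dy2 := dprog_mono (grows_cells G2) (dprog_mono (grows_cells G1) dy).
  have dl2 := dlist_mono (grows_cells G2) (dlist_mono (grows_cells G1) dl).
  have dz2 := dnat_mono (grows_cells G2) dz.
  have := Hk _ _ _ (grows_ready G2) dy2 (dlist_cons Hw dz2 dl2).
  move/can_bind; apply=> C3 G3 [u du Hu].
  inversion du as [|? u' c ? Hu' du']; subst.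
  apply: can_bind (can_cell tSucc z (inl 0) (grows_ready G3)) _ => C4 G4 [z' Hz'].
  have [_ S2 _] := G2; have [_ S3 _] := G3; have [_ S4 _] := G4.
  apply: (can_fire (i := 13) (vs := [:: y; l; z'; z; inl 0; w; u; u'; c])) => //.
  - exact: grows_ready G4.
  - do !split=> //; first by apply/S4/S3/S2.
    + by apply/S4/S3.
    + by apply/S4.
    + by apply/S4.
  - move=> C5 G5 H5; exists z' => //; apply: dnat_succ (grows_cells G5 Hz') _.
    by apply/(dnat_mono (grows_cells G5))/(dnat_mono (grows_cells G4))/(dnat_mono (grows_cells G3)).
apply: can_bind (Hmu n (leqnn n)) _ => C1 G1 [z dz Hz].
apply: can_bind (can_cell tCons z l (grows_ready G1)) _ => C2 G2 [w Hw].
have dy2 := dprog_mono (grows_cells G2) (dprog_mono (grows_cells G1) dy).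
have dl2 := dlist_mono (grows_cells G2) (dlist_mono (grows_cells G1) dl).
have dz2 := dnat_mono (grows_cells G2) dz.
have := IH0 _ _ _ (grows_ready G2) dy2 (dlist_cons Hw dz2 dl2).
move/can_bind; apply=> C3 G3 [u du Hu].
inversion du as [? c c' Hu0|]; subst.
have [_ S1 _] := G1; have [_ S2 _] := G2; have [_ S3 _] := G3.
apply: (can_fire (i := 9) (vs := [:: x; l; z; y; b; w; u; c; c'])) => //.
- exact: grows_ready G3.
- do !split=> //; first by apply/S3/S2/S1.
  + by apply/S3/S2.
  + by apply/S3.
- move=> C4 G4 H4; exists z => //.
  by apply/(dnat_mono (grows_cells G4))/(dnat_mono (grows_cells G3)).
Qed.

Lemma peval_can_eval p v y : peval p v y -> can_eval p v y.
Proof.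
move=> H; apply: (@peval_nested_ind can_eval can_evals _ _ _ _ _ _ _ _ _ _ _ _ H)
  => {p v y H}.
- move=> v C x l rC dx dl; inversion dx as [? a b Hx| | | | | |]; subst.
  have [t [a' [b' Hl]]] := dlist_cell dl.
  apply: can_bind (can_cell tZero (inl 0) (inl 0) rC) _ => C1 G1 [z Hz].
  have [_ S1 _] := G1.
  apply: (can_fire (i := 0) (vs := [:: x; l; z; a; b; t; a'; b'; inl 0; inl 0])) => //.
  + exact: grows_ready G1.
  + by do !split=> //; apply: S1.
  + by move=> C2 G2 H2; exists z => //; apply: dnat_zero (grows_cells G2 Hz).
- move=> v C x l rC dx dl; inversion dx as [|? q b Hx dq| | | | |]; subst.
  apply: can_bind (can_eval_proj rC dq dl) _ => C1 G1 [z dz Hz].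
  apply: can_bind (can_cell tSucc z (inl 0) (grows_ready G1)) _ => C2 G2 [u Hu].
  have [_ S1 _] := G1; have [_ S2 _] := G2.
  apply: (can_fire (i := 1) (vs := [:: x; l; u; q; b; z; inl 0])) => //.
  + exact: grows_ready G2.
  + by do !split=> //; do ?apply: S2 => //; apply: S1.
  + move=> C3 G3 H3; exists u => //; apply: dnat_succ (grows_cells G3 Hu) _.
    by apply/(dnat_mono (grows_cells G3))/(dnat_mono (grows_cells G2)).
- by move=> i v; apply: can_eval_proj.
- move=> f gs v ws y IHg IHf C x l rC dx dl.
  inversion dx as [| | | |? x1 x2 ? ? Hx df dg| |]; subst.
  apply: can_bind (IHg _ _ _ rC dg dl) _ => C1 G1 [w dw Hw].
  have df1 := dprog_mono (grows_cells G1) df.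
  apply: can_bind (IHf _ _ _ (grows_ready G1) df1 dw) _ => C2 G2 [z dz Hz].
  have [_ S1 _] := G1; have [_ S2 _] := G2.
  apply: (can_fire (i := 6) (vs := [:: x; l; z; x1; x2; w])) => //.
  + exact: grows_ready G2.
  + by do !split=> //; apply: S2 => //; apply: S1.
  + by move=> C3 G3 H3; exists z => //; apply: (dnat_mono (grows_cells G3)).
- move=> f g v y IH C x l rC dx dl.
  inversion dx as [| | | | |? x1 x2 ? ? Hx df dg|]; subst.
  inversion dl as [|? h t ? ? Hl dh dt]; subst.
  inversion dh as [? a b Hh|]; subst.
  apply: can_bind (IH _ _ _ rC df dt) _ => C1 G1 [z dz Hz].
  have [_ S1 _] := G1.
  apply: (can_fire (i := 7) (vs := [:: x; l; z; x1; x2; h; t; a; b])) => //.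
  + exact: grows_ready G1.
  + by do !split=> //; apply: S1.
  + by move=> C2 G2 H2; exists z => //; apply: (dnat_mono (grows_cells G2)).
- move=> f g n v z y IHz IHy C x l rC dx dl.
  inversion dx as [| | | | |? x1 x2 ? ? Hx df dg|]; subst.
  inversion dl as [|? h t ? ? Hl dh dt]; subst.
  inversion dh as [|? h' b ? Hh dh']; subst.
  (* [l1] names the arguments of the recursive call; [l3] and [l4] will name the list for the step,
     which contains its result [u]. *)
  apply: can_bind (can_cell tCons h' t rC) _ => C1 G1 [l1 Hl1].
  have dx1 := dprog_mono (grows_cells G1) dx.
  have dt1 := dlist_mono (grows_cells G1) dt.
  have dh1 := dnat_mono (grows_cells G1) dh'.
  have := IHz _ _ _ (grows_ready G1) dx1 (dlist_cons Hl1 dh1 dt1).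
  move/can_bind; apply=> C2 G2 [u du Hu].
  apply: can_bind (can_cell tCons u t (grows_ready G2)) _ => C3 G3 [l3 Hl3].
  apply: can_bind (can_cell tCons h' l3 (grows_ready G3)) _ => C4 G4 [l4 Hl4].
  have [_ S1 _] := G1; have [_ S2 _] := G2; have [_ S3 _] := G3; have [_ S4 _] := G4.
  have S14 w : cells_of (c_db C1) w -> cells_of (c_db C4) w.
    by move=> ?; apply/S4/S3/S2.
  have S24 w : cells_of (c_db C2) w -> cells_of (c_db C4) w by move=> ?; apply/S4/S3.
  have dg4 := dprog_mono (fun w H => S14 w (S1 _ H)) dg.
  have dl4 : dlist (cells_of (c_db C4)) l4 [:: n, z & v].
    apply: dlist_cons Hl4 (dnat_mono S14 dh1) _.
    exact: dlist_cons (grows_cells G4 Hl3) (dnat_mono S24 du) (dlist_mono S14 dt1).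
  apply: can_bind (IHy _ _ _ (grows_ready G4) dg4 dl4) _ => C5 G5 [k dk Hk].
  have [_ S5 _] := G5.
  apply: (can_fire (i := 8)
    (vs := [:: x; l; k; x1; x2; h; t; h'; b; l1; u; l4; l3])) => //.
  + exact: grows_ready G5.
  + do !split=> //; apply: S5 => //.
    * by apply/S14/S1.
    * by apply/S14/S1.
    * by apply/S14/S1.
    * by apply/S14.
    * by apply/S4/S3.
    * by apply/S4.
  + by move=> C6 G6 H6; exists k => //; apply: (dnat_mono (grows_cells G6)).
- exact: can_eval_mu.
- move=> v C x l rC dx dl; inversion dx as [? a b Hx|]; subst.
  have [t [a' [b' Hl]]] := dlist_cell dl.
  apply: can_bind (can_cell tNil (inl 0) (inl 0) rC) _ => C1 G1 [z Hz].
  have [_ S1 _] := G1.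
  apply: (can_fire (i := 10) (vs := [:: x; l; z; a; b; t; a'; b'; inl 0; inl 0])) => //.
  + exact: grows_ready G1.
  + by do !split=> //; apply: S1.
  + by move=> C2 G2 H2; exists z => //; apply: dlist_nil (grows_cells G2 Hz).
- move=> g gs v w ws IHg IHgs C x l rC dx dl.
  inversion dx as [|? x1 x2 ? ? Hx dg dgs]; subst.
  apply: can_bind (IHg _ _ _ rC dg dl) _ => C1 G1 [z dz Hz].
  have dgs1 := dprogs_mono (grows_cells G1) dgs.
  have dl1 := dlist_mono (grows_cells G1) dl.
  apply: can_bind (IHgs _ _ _ (grows_ready G1) dgs1 dl1) _ => C2 G2 [u du Hu].
  apply: can_bind (can_cell tCons z u (grows_ready G2)) _ => C3 G3 [k Hk].
  have [_ S1 _] := G1; have [_ S2 _] := G2; have [_ S3 _] := G3.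
  apply: (can_fire (i := 11) (vs := [:: x; l; k; x1; x2; z; u])) => //.
  + exact: grows_ready G3.
  + do !split=> //; do ?apply: S3 => //; apply: S2 => //; exact: S1.
  + move=> C4 G4 H4; exists k => //.
    have S24 w' : cells_of (c_db C2) w' -> cells_of (c_db C4) w'.
      by move=> ?; apply/(grows_cells G4)/S3.
    apply: dlist_cons (grows_cells G4 Hk) _ (dlist_mono S24 du).
    exact/(dnat_mono S24)/(dnat_mono (grows_cells G2)).
Qed.

Lemma interp_complete C nu p n : ready C ->
  has_cells (cells_of (c_db C)) nu (run_cells p n) -> peval p [:: n] 1 ->
  can C (fun D => D (rGoal, [:: nu 5; nu 1])).
Proof.
move=> rC /has_run_cells[dp dl] /peval_can_eval /(_ _ _ _ rC dp dl) H.
apply: can_bind H _ => C1 G1 [z dz Hz].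
inversion dz as [|? z' b ? Hz1 dz']; subst; inversion dz' as [? c c' Hz'|]; subst.
apply: (can_fire (i := 14) (vs := [:: nu 5; nu 1; z; z'; b; c; c'])) => //.
exact: grows_ready G1.
Qed.

End Completeness.

(** * Stability as non-termination with value 1 *)

Definition goal_query : query :=
  ([::], [:: (rGoal, [:: inr (inl 5); inr (inl 1)])]).

Definition query_atom (q : cell) : atom := cell_atom q.1.1.1 q.1.1.2 q.1.2 q.2.

Lemma boolean_query_stable P I D tau (atoms : seq atom) :
  (forall nu, ~ forall a, a \in atoms -> holds_atom (db_of D) nu a) ->
  globally_stable P I D tau ([::], atoms) <->
  forall C, reaches P (Cfg I (db_of D) tau) C ->
    forall nu, ~ forall a, a \in atoms -> holds_atom (c_db C) nu a.
Proof.
move=> H0; split=> [H C R nu Hnu|H C R tup].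
  have [_ []] := H C R [::]; first by exists nu.
  by move=> nu' [/H0].
by split=> -[nu [/= Hnu _]]; [case: (H0 nu) | case: (H C R nu)].
Qed.

Lemma ready_init s2 s3 :
  ready (Cfg (map const_inst s2) (db_of (map const_fact s3)) (posnat 0)).
Proof. by split=> [f /mapP[q _ ->] //|]; exists 0 => k _ /mapP[]. Qed.

Lemma can_const s q C : q \in s -> ready C -> can s C (fun D => D (const_fact q)).
Proof.
move=> Hq [HI [K HK]].
have Ht : const_trans q \in p_trans (interp s) by rewrite /= mem_cat map_f.
have R := @reach_fire s C _ (image_cell inl q) Ht erefl erefl.
pose nu : valuation := nth (inl 0) (image_cell inl q ++ [:: inr (c_time C)]).
eexists; first split.
- apply: R; exists (fun=> inr (c_time C)); split=> [a|]; last by split.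
  by rewrite inE => /eqP->; right.
- by left.
- by split=> [f /= [/HI //|[-> _]] //|]; exists K => k /HK Hk [/Hk //|[]].
right; split=> //; exists nu; split=> //; split=> [a|]; last by split.
by rewrite inE => /eqP->; right.
Qed.

Lemma can_consts s s' C : {subset s' <= s} -> ready C ->
  can s C (fun D => has_cells (cells_of D) inl s').
Proof.
elim: s' C => [|q s' IH] C ss rC; first exact: can_now.
have ss' : {subset s' <= s} by move=> x Hx; apply: ss; rewrite inE Hx orbT.
apply: can_bind (can_const (ss q (mem_head _ _)) rC) _ => C1 G1 H1.
apply: can_bind (IH _ ss' (grows_ready G1)) _ => C2 G2 H2.
apply: can_now (grows_ready G2) _; apply/has_cells_cons; split=> //.
exact: (grows_cells G2).
Qed.

Lemma can_load s s' I D tau :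
  ready (Cfg (I ++ map const_inst s') D tau) ->
  can s (Cfg (I ++ map const_inst s') D tau)
    (fun D => has_cells (cells_of D) inl s').
Proof.
elim: s' I D => [|q s' IH] I D rC; first exact: can_now.
have Ht : load_trans \in p_trans (interp s).
  by apply: mem_interp_trans; rewrite !inE eqxx ?orbT.
pose r : record := (image_cell inl q, posnat 0).
pose D1 f := D f \/ f = In_fact r.
pose D2 f := D f \/ rule_out D1 cell_rule f.
have H2 : D2 (const_fact q).
  right; split=> //; exists (nth (inl 0) (r.1 ++ [:: inr r.2])); split=> //.
  split=> [a|]; last by split.
  by rewrite inE => /eqP->; right.
have G1 : grows s (Cfg (I ++ map const_inst (q :: s')) D tau)
    (Cfg ((I ++ [:: (atEnd, r)]) ++ map const_inst s') D2 tau).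
  rewrite -catA; case: rC => HI [K HK]; split.
  - apply: rt_step; apply: (step_traverse I (map const_inst s') tau Ht) => //.
    by exists (fun=> inl 0); split.
  - by left.
  - by split=> [f /= [/HI //|[-> _]] //|]; exists K => k /HK Hk [/Hk //|[]].
apply: grows_can (G1) _; apply: can_bind (IH _ _ (grows_ready G1)) _ => C2 G2 HC2.
apply: can_now (grows_ready G2) _; apply/has_cells_cons; split=> //.
exact: (grows_cells G2).
Qed.

(** [s1], [s2] and [s3] are the cells carried by the transitions, the running instances and the
    database. Soundness only needs them to come from [s]; completeness needs the process to be able
    to assemble all of [s]. *)
Lemma goal_stable s1 s2 s3 p n (s := run_cells p n)
    (C := Cfg (map const_inst s2) (db_of (map const_fact s3)) (posnat 0)) :
  {subset s1 <= s} -> {subset s2 <= s} -> {subset s3 <= s} ->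
  can s1 C (fun D => has_cells (cells_of D) inl s) ->
  globally_stable (interp s1) (map const_inst s2) (map const_fact s3) (posnat 0)
    goal_query <-> ~ peval p [:: n] 1.
Proof.
move=> H1 H2 H3 Hload; rewrite boolean_query_stable; last first.
  by move=> nu /(_ _ (mem_head _ _)) /mapP[].
split=> [H /interp_complete E|H C' R nu /(_ _ (mem_head _ _)) Hgoal].
  have [C2 [R2 _ _] HC2] : can s1 C (fun D => D (rGoal, [:: inl 5; inl 1])).
    apply: can_bind Hload _ => C1 G1 HC1.
    by apply: (E _ _ inl) HC1; apply: grows_ready G1.
  apply: (H C2 R2 (fun=> inl 0)) => a; by rewrite inE => /eqP->.
have [N [HN _ Hg]] := interp_sound H1 H2 H3 (run_cells_uniq p n) R.
have [dp dl] := has_run_cells HN.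
exact/H/(Hg _ _ _ _ Hgoal).
Qed.

(** A match may send the cell variables to any names, even with repetitions: its image still
    describes [p] and the list of [n], and soundness asks for nothing more. Conversely the process
    claims [posnat x] for each variable [x]. *)
Lemma query_stable p n :
  globally_stable (interp [::]) [::] [::] (posnat 0)
    ([::], map query_atom (run_cells p n) ++ [:: rel_atom rGoal [:: 5; 1]])
  <-> ~ peval p [:: n] 1.
Proof.
have goal_in : rel_atom rGoal [:: 5; 1] \in
    map query_atom (run_cells p n) ++ [:: rel_atom rGoal [:: 5; 1]].
  by rewrite mem_cat mem_head orbT.
rewrite boolean_query_stable; last by move=> nu /(_ _ goal_in).
split=> [H /interp_complete E|H C R nu Hnu].
  pose nu : valuation := inr \o posnat.
  have [C2 [R2 _ _] [HC2 HG]] : can [::] (Cfg [::] (db_of [::]) (posnat 0))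
      (fun D => has_cells (cells_of D) nu (run_cells p n) /\
                D (rGoal, [:: nu 5; nu 1])).
    have r0 := ready_init [::] [::].
    apply: can_bind (create_cells [::] r0 _ (run_cells_uniq p n)) _ => //.
    move=> C1 G1 HC1; apply: can_bind (E _ _ nu (grows_ready G1) HC1) _ => C2 G2 HC2.
    apply: can_now (grows_ready G2) _; split=> // q /HC1; exact: (grows_cells G2).
  apply: (H C2 R2 nu) => a; rewrite mem_cat => /orP[/mapP[q /HC2 Hq ->] //|].
  by rewrite inE => /eqP->.
(* No cells are given in advance; those of the program come from the match itself. *)
have [N [_ HN Hg]] := @interp_sound [::] [::] [::] [::] (fun _ => id) (fun _ => id)
  (fun _ => id) isT _ R.
have [dp dl] : dprog N (nu 5) p /\ dlist N (nu 1) [:: n].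
  apply: has_run_cells => q Hq; apply/HN/(Hnu (query_atom q)).
  by rewrite mem_cat map_f.
by apply/H/(Hg (nu 5) (nu 1)) => //; apply: (Hnu _ goal_in).
Qed.

(** * Well-formedness, computable encodings and the four reductions *)

(** The last conjunct is safety; the atoms [rCell] with an arbitrary tag in [clauses] are there to
    bind head variables that nothing else binds. *)
Definition wf_clause (cl : clause) : bool :=
  [&& cl.1.1 != In_sym, (cl.1.1, size cl.1.2) \in interp_schema,
      all (wf_atom interp_schema 4 true) cl.2 &
      all (mem (pos_vars (cl.2, [::], [::]))) cl.1.2].

Lemma interp_wf s : wf_process (interp s).
Proof.
have Hrec w : w \in [:: cell_rule; used_rule] -> wf_rule interp_schema 4 w.
  rewrite !inE => /orP[]/eqP->; do !split=> //; move=> ?; rewrite !inE.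
  - by move/eqP->.
  - by case/or4P=> /eqP->.
  - by move/eqP->.
  - by move/eqP->.
split=> //; split; first by move=> p; apply/allP: p.
split=> // t /interp_transP[q _|cl Hcl|||]; split=> //; try by apply: Hrec.
- by move=> a; rewrite inE => /eqP->.
- have /and4P[H1 H2 /allP H3 /allP H4] := allP (isT : all wf_clause clauses) _ Hcl.
  split=> //; split=> //; split; last by split.
  by move=> a; rewrite cats0; apply: H3.
- by move=> a; rewrite !inE => /orP[]/eqP->.
Qed.

Lemma interp_wf_input s1 s2 s3 Q :
  (forall a, a \in Q.2 -> wf_atom interp_schema 4 false a) -> Q.1 = [::] ->
  wf_input (interp s1) (map const_inst s2) (map const_fact s3) Q.
Proof.
move=> HQ Q1; split; first exact: interp_wf.
split; first by move=> o /mapP[q _ ->].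
split; first by move=> f /mapP[q _ ->].
by split; last by rewrite Q1.
Qed.

Lemma goal_query_wf a : a \in goal_query.2 -> wf_atom interp_schema 4 false a.
Proof. by rewrite inE => /eqP->. Qed.

(* The shape is matched syntactically: unification would unfold [pickle] and
   normalize unary codes. *)
Ltac computable_pickle :=
  lazymatch goal with
  | |- computable ?a (fun=> ?n) => exact (computable_const a n)
  | |- computable _ (fun v => pickle (_, _)) =>
      apply: computable_pickle_pair; computable_pickle
  | |- computable _ (fun v => pickle (_ :: _)) =>
      apply: computable_pickle_cons; computable_pickle
  | |- computable _ (fun v => pickle (inl _)) =>
      apply: computable_pickle_inl; computable_pickle
  | |- computable _ (fun v => pickle (inr _)) =>
      apply: computable_pickle_inr; computable_pickle
  | |- _ => assumption
  end.

Section Encodings.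
Variables (a : nat) (x t y z : seq nat -> nat).
Hypotheses (Hx : computable a x) (Ht : computable a t).
Hypotheses (Hy : computable a y) (Hz : computable a z).

Lemma computable_const_fact :
  computable a (fun v => pickle (const_fact (x v, t v, y v, z v))).
Proof. by rewrite /const_fact /image_cell /=; computable_pickle. Qed.

Lemma computable_const_inst :
  computable a (fun v => pickle (const_inst (x v, t v, y v, z v))).
Proof. by rewrite /const_inst /image_cell /=; computable_pickle. Qed.

Lemma computable_const_trans :
  computable a (fun v => pickle (const_trans (x v, t v, y v, z v))).
Proof. by rewrite /const_trans /=; computable_pickle. Qed.

Lemma computable_query_atom :
  computable a (fun v => pickle (query_atom (x v, t v, y v, z v))).
Proof. by rewrite /query_atom /cell_atom /=; computable_pickle. Qed.

End Encodings.

Theorem theorem3 :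
  (* data complexity: P, I, tau, Q fixed (P acyclic), the database varies *)
  (exists (P : process) (I : instpart) (tau : posrat) (Q : query),
     acyclic P /\
     ~ decidable_on (fun D : database => wf_input P I D Q)
                    (fun D => globally_stable P I D tau Q)) /\
  (* process complexity: the (acyclic) process model varies *)
  (exists (I : instpart) (D : database) (tau : posrat) (Q : query),
     ~ decidable_on (fun P : process => acyclic P /\ wf_input P I D Q)
                    (fun P => globally_stable P I D tau Q)) /\
  (* query complexity: the query varies *)
  (exists (P : process) (I : instpart) (D : database) (tau : posrat),
     acyclic P /\
     ~ decidable_on (fun Q : query => wf_input P I D Q)
                    (fun Q => globally_stable P I D tau Q)) /\
  (* instance complexity: the instance part varies *)
  (exists (P : process) (D : database) (tau : posrat) (Q : query),
     acyclic P /\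
     ~ decidable_on (fun I : instpart => wf_input P I D Q)
                    (fun I => globally_stable P I D tau Q)) /\
  (* fresh MDABPs: instance complexity is constant (the answer does not
     depend on the instance part) *)
  (forall (P : process) (D : database) (tau : posrat) (Q : query),
     exists b : bool, forall I : instpart,
       fresh I -> wf_input P I D Q ->
       (globally_stable P I D tau Q <-> b)).
Proof.
have sub0 (s : seq cell) : {subset [::] <= s} by [].
have nil_init s := ready_init [::] s.
split; [|split; [|split; [|split]]].
- exists (interp [::]), [::], (posnat 0), goal_query; split; first exact: interp_acyclic.
  apply: (undecidable_of_run_cells (enc := const_fact) (wrap := id) (rest := [::])
           (wrapn := id)) => //.
  + exact: computable_const_fact.
  + exact: computable_nth.
  + by move=> p n; rewrite cats0; apply: (@interp_wf_input _ [::]) => //; apply: goal_query_wf.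
  + move=> p n; rewrite cats0; apply: (@goal_stable [::] [::]) => //.
    by apply: can_now (nil_init _) _ => q Hq; apply: map_f.
- exists [::], [::], (posnat 0), goal_query.
  apply: (undecidable_of_run_cells (enc := const_trans) (wrap := process_of_trans)
           (rest := interp_trans)
           (* This is the code of a pair whose first component, everything but the transitions, is
              fixed. *)
           (wrapn := fun m => 2 ^ pickle (process_of_trans [::]).1 *
                              (2 ^ m * 0.*2.+1).*2.+1)) => //.
  + exact: computable_const_trans.
  + do 2?[apply: computable_code_cons; try exact: computable_const].
    exact: computable_nth.
  + move=> p n; split; first exact: interp_acyclic.
    by apply: (@interp_wf_input _ [::] [::]) => //; apply: goal_query_wf.
  + move=> p n; apply: (@goal_stable _ [::] [::]) => //.
    exact: can_consts (nil_init [::]).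
- exists (interp [::]), [::], [::], (posnat 0); split; first exact: interp_acyclic.
  apply: (undecidable_of_run_cells (enc := query_atom)
           (wrap := fun atoms => ([::], atoms) : query)
           (rest := [:: rel_atom rGoal [:: 5; 1]])
           (wrapn := fun m => 2 ^ 0 * (2 ^ m * 0.*2.+1).*2.+1)) => //.
  + exact: computable_query_atom.
  + do 2?[apply: computable_code_cons; try exact: computable_const].
    exact: computable_nth.
  + move=> p n; apply: (@interp_wf_input _ [::] [::]) => // a.
    rewrite mem_cat => /orP[/mapP[q _ ->] //|].
    by rewrite inE => /eqP->.
  + exact: query_stable.
- exists (interp [::]), [::], (posnat 0), goal_query; split; first exact: interp_acyclic.
  apply: (undecidable_of_run_cells (enc := const_inst) (wrap := id) (rest := [::])
           (wrapn := id)) => //.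
  + exact: computable_const_inst.
  + exact: computable_nth.
  + by move=> p n; rewrite cats0; apply: (@interp_wf_input _ _ [::]) => //; apply: goal_query_wf.
  + move=> p n; rewrite cats0; apply: (@goal_stable [::] _ [::]) => //.
    exact: (@can_load [::] _ [::] _ _ (ready_init (run_cells p n) [::])).
- move=> P D tau Q.
  (* The empty instance part is the only fresh one, so a single truth value has to be returned. *)
  case: (classic (globally_stable P [::] D tau Q)) => H.
    by exists true => _ -> _.
  by exists false => _ -> _.
Qed.
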